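(* Let $\tau:\Sigma\times\mathbb Z^d\to\Sigma\times\mathbb Z^d$ be a twisted skew product with twisting matrix $A$, height function $h$, and base shift $(\Sigma,\sigma)$ a transitive subshift of finite type. The following are equivalent: (a) $\tau$ is totally transitive; (b) $\rho(A)=1$, $\tau$ has the total ftp, and $0\in\mathrm{Int}\big(\mathrm{rot}_F(\tau^{N(A)})\big)$; (c) $\tau$ has the total ftp and its periodic points are dense in $\Sigma\times\mathbb Z^d$; (d) $\tau$ is topologically mixing.
   Context: Countable state Markov shift: a countable set $S$ of states and a $\{0,1\}$-matrix $C=(C_{ij})_{i,j\in S}$ with finite row and column sums; $\Sigma=\{s\in S^{\mathbb Z}:C_{s_is_{i+1}}=1\ \forall i\}$ with the product of discrete topologies, $\sigma$ the left shift. If $S$ is finite it is a subshift of finite type. Twisted skew product: given $(\Sigma,\sigma)$, a finitely generated abelian group $G$ (discrete), a height function $h:\Sigma\to G$ with $h(s)$ depending only on $(s_0,s_1)$, and an automorphism $\Psi$ of $G$ (twisting automorphism; for $G=\mathbb Z^d$ given by an integer matrix $A$ of determinant $\pm1$, the twisting matrix), $\tau(s,g)=(\sigma(s),\Psi(g)+h(s))$. It is untwisted if $\Psi=\mathrm{id}$. Iterates $\tau^k$ ($k>0$) have the same form with twisting $\Psi^k$. For a subgroup $\Gamma$ with $\Psi(\Gamma)=\Gamma$, the quotient is $\tau_\Gamma(s,g+\Gamma)=(\sigma(s),\Psi(g)+h(s)+\Gamma)$ on $\Sigma\times G/\Gamma$. A homeomorphism is transitive if for all nonempty open $U,V$ some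 $n\in\mathbb Z$ has $g^n(U)\cap V\ne\emptyset$; totally transitive if all positive iterates are transitive; topologically mixing if $g^n(U)\cap V\ne\emptyset$ for all large $n$. ftp: for $G=\mathbb Z^d$, $\tau$ has the finite transitivity property (ftp) if $\tau_\Gamma$ is transitive for every $\Psi$-invariant subgroup $\Gamma\subset\mathbb Z^d$ of finite index; it has the total ftp if $\tau^k$ has the ftp for all $k>0$. Pure subgroup: $\Gamma\subset\mathbb Z^d$ with $\mathbb Z^d/\Gamma$ torsion-free; purification $P(X)$ = smallest pure subgroup containing $X$. Fried quotient: $\tau_F$ with $F=P(\mathrm{im}(\Psi-\mathrm{id}))$; it is untwisted with group $\mathbb Z^d/F\cong\mathbb Z^k$. For an untwisted skew product with group $\mathbb Z^k$: $h(s,n)=\sum_{i=0}^{n-1}h(\sigma^is)$, the rotation vector is $\mathrm{rot}(s)=\lim_{n\to\infty}h(s,n)/n\in\mathbb R^k$ when it exists, and $\mathrm{rot}(\tau)$ is the set of all rotation vectors. $\mathrm{rot}_F(\tau)=\mathrm{rot}(\tau_F)\subset\mathbb R^k$ (empty if $k=0$); interior is in $\mathbb R^k$. $\rho(A)$ is the spectral radius; if $\rho(A)=1$, $N(A)$ is the least positive integer with $\mathrm{spec}(A^{N(A)})=\{1\}$. *)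

(* Defs.v *)
From Stdlib Require Import ZArith Reals.
From HB Require Import structures.
From mathcomp Require Import all_boot all_order all_algebra all_field.
Set Implicit Arguments. Unset Strict Implicit. Unset Printing Implicit Defensive.
Import Order.TTheory GRing.Theory Num.Theory.
Local Open Scope ring_scope.

Section Dyn.
Variable X : Type.
Variable isopen : (X -> Prop) -> Prop.

Definition nonempty (U : X -> Prop) := exists x, U x.

(* g^n(U) meets V for some n in Z; for n < 0 this is U meeting g^|n|(V). *)
Definition meets_some (g : X -> X) (U V : X -> Prop) : Prop :=
  exists n : nat, (exists x, U x /\ V (iter n g x)) \/ (exists x, V x /\ U (iter n g x)).

Definition top_transitive (g : X -> X) : Prop :=
  forall U V, isopen U -> isopen V -> nonempty U -> nonempty V -> meets_some g U V.

Definition totally_transitive (g : X -> X) : Prop :=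
  forall k : nat, (0 < k)%N -> top_transitive (iter k g).

Definition top_mixing (g : X -> X) : Prop :=
  forall U V, isopen U -> isopen V -> nonempty U -> nonempty V ->
    exists N : nat, forall n : nat, (N <= n)%N -> exists x, U x /\ V (iter n g x).

Definition periodic_dense (g : X -> X) : Prop :=
  forall U, isopen U -> nonempty U ->
    exists x, U x /\ exists n : nat, (0 < n)%N /\ iter n g x = x.

(* Transitivity of the map induced by g on the quotient X / Rel: the open
   sets of the quotient are the images of the Rel-saturated open sets. *)
Definition saturated (Rel : X -> X -> Prop) (U : X -> Prop) :=
  forall x y, Rel x y -> U x -> U y.

Definition transitive_mod (Rel : X -> X -> Prop) (g : X -> X) : Prop :=
  forall U V, isopen U -> isopen V -> saturated Rel U -> saturated Rel V ->
    nonempty U -> nonempty V -> meets_some g U V.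
End Dyn.

Definition Sig (S : Type) (C : S -> S -> bool) :=
  {s : Z -> S | forall i : Z, C (s i) (s (Z.add i 1))}.

Definition sshift (S : Type) (C : S -> S -> bool) (x : Sig C) : Sig C :=
  exist (fun s : Z -> S => forall i : Z, C (s i) (s (Z.add i 1)))
        (fun i => sval x (Z.add i 1)) (fun i => proj2_sig x (Z.add i 1)).

(* product of discrete topologies: cylinder neighbourhoods *)
Definition sig_open (S : Type) (C : S -> S -> bool) (U : Sig C -> Prop) : Prop :=
  forall x, U x -> exists n : nat, forall y : Sig C,
    (forall i : Z, (Z.le (Z.opp (Z.of_nat n)) i /\ Z.le i (Z.of_nat n)) -> sval y i = sval x i) -> U y.

Definition prod_open (S : Type) (C : S -> S -> bool) (d : nat)
  (U : Sig C * 'cV[int]_d -> Prop) : Prop :=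
  forall x, U x -> exists n : nat, forall y : Sig C * 'cV[int]_d,
    y.2 = x.2 ->
    (forall i : Z, (Z.le (Z.opp (Z.of_nat n)) i /\ Z.le i (Z.of_nat n)) -> sval y.1 i = sval x.1 i) -> U y.

Definition tau (S : Type) (C : S -> S -> bool) (d : nat) (A : 'M[int]_d)
  (hh : S -> S -> 'cV[int]_d) (x : Sig C * 'cV[int]_d) : Sig C * 'cV[int]_d :=
  (sshift x.1, (A *m x.2 + hh (sval x.1 Z0) (sval x.1 (Zpos xH)))%R).

Definition is_subgroup (d : nat) (G : 'cV[int]_d -> Prop) : Prop :=
  G 0%R /\ forall x y, G x -> G y -> G (x - y)%R.

Definition finite_index (d : nat) (G : 'cV[int]_d -> Prop) : Prop :=
  exists l : seq 'cV[int]_d, forall g, exists2 r, r \in l & G (g - r)%R.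

(* Psi(G) = G for Psi = multiplication by M (M invertible over Z) *)
Definition mx_invariant (d : nat) (M : 'M[int]_d) (G : 'cV[int]_d -> Prop) : Prop :=
  forall g, G g <-> G (M *m g).

Definition is_pure (d : nat) (G : 'cV[int]_d -> Prop) : Prop :=
  forall (g : 'cV[int]_d) (n : int), n != 0%R -> G (n *: g)%R -> G g.

Definition purification (d : nat) (Xs : 'cV[int]_d -> Prop) (g : 'cV[int]_d) : Prop :=
  forall G, is_subgroup G -> is_pure G -> (forall x, Xs x -> G x) -> G g.

Definition im_minus_id (d : nat) (M : 'M[int]_d) (g : 'cV[int]_d) : Prop :=
  exists x, g = (M *m x - x)%R.

Definition modrel (S : Type) (C : S -> S -> bool) (d : nat) (G : 'cV[int]_d -> Prop)
  (x y : Sig C * 'cV[int]_d) : Prop := x.1 = y.1 /\ G (x.2 - y.2)%R.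

(* ftp for a map g on Sig C * Z^d which is a twisted skew product with
   twisting matrix M *)
Definition ftp (S : Type) (C : S -> S -> bool) (d : nat) (M : 'M[int]_d)
  (g : Sig C * 'cV[int]_d -> Sig C * 'cV[int]_d) : Prop :=
  forall G, is_subgroup G -> finite_index G -> mx_invariant M G ->
    transitive_mod (@prod_open S C d) (@modrel S C d G) g.

Definition total_ftp (S : Type) (C : S -> S -> bool) (d : nat) (A : 'M[int]_d)
  (hh : S -> S -> 'cV[int]_d) : Prop :=
  forall k : nat, (0 < k)%N -> @ftp S C d (A ^+ k)%R (iter k (tau A hh)).

Definition int2R (z : int) : R :=
  match z with Posz n => INR n | Negz n => Ropp (INR n.+1) end.

(* rot(s) = v for the untwisted skew product over base T with height H : Sig -> Z^k *)
Definition rot_at (S : Type) (C : S -> S -> bool) (k : nat) (T : Sig C -> Sig C)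
  (H : Sig C -> 'cV[int]_k) (s : Sig C) (v : 'I_k -> R) : Prop :=
  forall j : 'I_k,
    Un_cv (fun n : nat => Rdiv (int2R ((\sum_(i < n) H (iter i T s))%R j 0)) (INR n)) (v j).

Definition rot_set (S : Type) (C : S -> S -> bool) (k : nat) (T : Sig C -> Sig C)
  (H : Sig C -> 'cV[int]_k) (v : 'I_k -> R) : Prop :=
  exists s, rot_at T H s v.

Definition zero_in_interior (k : nat) (E : ('I_k -> R) -> Prop) : Prop :=
  exists eps : R, Rlt 0 eps /\
    forall v : 'I_k -> R, (forall j, Rlt (Rabs (v j)) eps) -> E v.

(* 0 in Int(rot_F(tau^N)): the Fried quotient of tau^N is taken with respect
   to an isomorphism Z^d/F ~ Z^k given by a surjection P : Z^d -> Z^k with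
   kernel F = P(im(A^N - id)); rot_F is empty if k = 0. *)
Definition zero_in_int_rotF (S : Type) (C : S -> S -> bool) (d : nat) (A : 'M[int]_d)
  (hh : S -> S -> 'cV[int]_d) (N : nat) : Prop :=
  exists (k : nat) (P : 'M[int]_(k, d)),
    (0 < k)%N /\
    (forall y : 'cV[int]_k, exists x, P *m x = y) /\
    (forall x, P *m x = 0%R <-> purification (im_minus_id (A ^+ N)%R) x) /\
    zero_in_interior
      (rot_set (iter N (@sshift S C))
               (fun s => P *m (iter N (tau A hh) (s, 0%R)).2)).

Definition cpoly (d : nat) (M : 'M[int]_d) : {poly algC} :=
  char_poly (map_mx (fun z : int => (z%:~R : algC)) M).

Definition spec_radius_one (d : nat) (A : 'M[int]_d) : Prop :=
  (forall l : algC, root (cpoly A) l -> (`|l| <= 1)%R) /\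
  (exists l : algC, root (cpoly A) l /\ `|l| = 1%R).

Definition spec_is_one (d : nat) (M : 'M[int]_d) : Prop :=
  (forall l : algC, root (cpoly M) l -> l = 1%R) /\ (exists l : algC, root (cpoly M) l).

Definition is_NA (d : nat) (A : 'M[int]_d) (N : nat) : Prop :=
  (0 < N)%N /\ spec_is_one (A ^+ N)%R /\
  forall M : nat, (0 < M)%N -> (M < N)%N -> ~ spec_is_one (A ^+ M)%R.

(* Main.v *)
(* For states i, j and heights g, g' let (i, g) -> (j, g') mean that some path of
   the shift leads from i to j and carries g to g'. Transitivity of all powers
   amounts to: for every K every two pairs are joined in this sense by a path of
   length in K N. Return times are then eventually all integers, hence (d), and
   closing up paths gives periodic points.

   Suppose that -> along lengths in K N is symmetric at a state i. The
   translations preserving its classes form a subgroup Lam containing the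
   differences of displacements of loops of equal length; the total ftp, used
   for a power acting trivially on Z^d / n Z^d, forces Lam + n Z^d = Z^d for all
   n, so Lam = Z^d. Dense periodic points give symmetry at once. Under (b) let
   nil = A^N - 1, which is nilpotent. Symmetry modulo im nil follows from
   0 being interior to the rotation set. If z = nil y and reachability is
   already total modulo W + Z z, then moving by multiples of y before running a
   loop produces drifts along z of both signs, which gives symmetry, hence
   totality, modulo W; one descends along im nil > im nil^2 > ... > 0.

   Conversely an eigenvalue of modulus > 1 yields a functional that grows along
   orbits; Kronecker's theorem then makes all eigenvalues roots of unity, and
   concatenating loops of a common length whose heights in the Fried quotient
   are the vectors with entries in {-1, 0, 1} realizes all small rotation
   vectors. *)
Require Import Defs.
From Stdlib Require Import ZArith Reals Lra FunctionalExtensionality ClassicalEpsilon.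
From HB Require Import structures.
From mathcomp Require Import all_boot all_order all_algebra all_field.
From mathcomp Require Import zify ssrZ ring.
Delimit Scope Z_scope with ZZ.
Set Implicit Arguments. Unset Strict Implicit. Unset Printing Implicit Defensive.

(** * Preliminaries: integer vectors, subgroups of Z^d, finite choice *)

Section Entries.
Import GRing.Theory.
Local Open Scope ring_scope.
Variables (m n : nat).
Implicit Types x y : 'M[int]_(m, n).
Lemma addmx_entry x y i j : (x + y) i j = x i j + y i j. Proof. by rewrite mxE. Qed.
Lemma oppmx_entry x i j : (- x) i j = - x i j. Proof. by rewrite mxE. Qed.
Lemma zeromx_entry i j : (0 : 'M[int]_(m, n)) i j = 0. Proof. by rewrite mxE. Qed.
Lemma scalemx_entry (a : int) x i j : (a *: x) i j = a * x i j. Proof. by rewrite mxE. Qed.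
End Entries.

(* Decides identities between Z-linear combinations of integer matrices. *)
Ltac zmod := apply/matrixP => ? ?;
  rewrite !(addmx_entry, oppmx_entry, zeromx_entry, scalemx_entry); ring.

Section Subgroups.
Import Order.TTheory GRing.Theory Num.Theory.
Local Open Scope ring_scope.
Variables (d : nat) (G : 'cV[int]_d -> Prop).
Hypothesis Ggrp : is_subgroup G.

Lemma subgroup0 : G 0. Proof. by case: Ggrp. Qed.
Lemma subgroupB x y : G x -> G y -> G (x - y). Proof. by case: Ggrp => _; apply. Qed.
Lemma subgroupN x : G x -> G (- x).
Proof. by move=> Gx; rewrite -sub0r; apply: subgroupB => //; apply: subgroup0. Qed.
Lemma subgroupD x y : G x -> G y -> G (x + y).
Proof. by move=> Gx Gy; rewrite -[y]opprK; apply: subgroupB => //; apply: subgroupN. Qed.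
Lemma subgroupMn x (n : nat) : G x -> G (x *+ n).
Proof.
move=> Gx; elim: n => [|n IHn]; first by rewrite mulr0n; apply: subgroup0.
by rewrite mulrS; apply: subgroupD.
Qed.
Lemma subgroupZ x (a : int) : G x -> G (a *: x).
Proof.
move=> Gx; rewrite -[a]intz -[a%:~R]/(1 *~ a) scaler_int.
case: a => n; first exact: subgroupMn.
by rewrite NegzE mulrNz; apply: subgroupN; apply: subgroupMn.
Qed.
Lemma subgroup_sum (I : Type) (r : seq I) (P : pred I) (F : I -> 'cV[int]_d) :
  (forall i, G (F i)) -> G (\sum_(i <- r | P i) F i).
Proof.
by move=> GF; apply: big_ind => // [|x y]; [apply: subgroup0 | apply: subgroupD].
Qed.
End Subgroups.

Section Pigeonhole.

Lemma pigeonhole (T : finType) (f : nat -> T) : exists a b, a < b /\ f a = f b.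
Proof.
pose g (k : 'I_#|T|.+1) := f k.
have : ~ injective g.
  by move=> /leq_card; rewrite card_ord ltnn.
move=> ginj; apply: NNPP => nex; apply: ginj => x y gxy; apply: ord_inj.
by case: (ltngtP x y) => // xy; exfalso; apply: nex;
  [exists x, y | exists y, x]; split.
Qed.

Lemma fin_all_bound (T : finType) (P : T -> nat -> Prop) :
  (forall x m n, m <= n -> P x m -> P x n) -> (forall x, exists m, P x m) ->
  exists m, forall x, P x m.
Proof.
move=> Pmon /fin_all_exists[f Pf]; exists (\max_x f x) => x.
by apply: Pmon (Pf x); apply: leq_bigmax.
Qed.

End Pigeonhole.

(** * Two-sided sequences *)

Section Shift.
Variables (S : Type) (C : S -> S -> bool).
Notation Sg := (Sig C).

Definition state_at (s : Sg) (n : nat) : S := sval s (Z.of_nat n).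

Lemma sig_ext (s t : Sg) : (forall z, sval s z = sval t z) -> s = t.
Proof.
case: s t => [s ps] [t pt] /= /functional_extensionality est.
by subst t; congr exist; apply: proof_irrelevance.
Qed.

(** Unlike for iterates of [sshift], [k] may be negative; this supplies the inverse of the shift. *)
Definition shiftZ (k : Z) (s : Sg) : Sg.
Proof.
exists (fun i => sval s (i + k)%ZZ) => i.
have -> : (i + 1 + k = i + k + 1)%ZZ by lia.
exact: (proj2_sig s (i + k)%ZZ).
Defined.

Lemma sval_shiftZ k s z : sval (shiftZ k s) z = sval s (z + k)%ZZ.
Proof. by []. Qed.

Lemma sval_iter_shift m (s : Sg) z :
  sval (iter m (@sshift S C) s) z = sval s (z + Z.of_nat m)%ZZ.
Proof.
elim: m z => [|m IHm] z /=; first by rewrite Z.add_0_r.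
by rewrite IHm; congr (sval s); lia.
Qed.

Lemma state_iter_shift m (s : Sg) n :
  state_at (iter m (@sshift S C) s) n = state_at s (m + n).
Proof. by rewrite /state_at sval_iter_shift; congr (sval s); lia. Qed.

(** The Markov condition only involves adjacent symbols, so a past and a future can be joined
    wherever they share one symbol. *)
Lemma glue (s s' : Sg) (m : nat) : state_at s m = state_at s' 0 ->
  exists t : Sg, (forall z, (z <= Z.of_nat m)%ZZ -> sval t z = sval s z) /\
    (forall z, (0 <= z)%ZZ -> sval t (Z.of_nat m + z)%ZZ = sval s' z).
Proof.
rewrite /state_at /= => ess.
pose f z := if (z <=? Z.of_nat m)%ZZ then sval s z else sval s' (z - Z.of_nat m)%ZZ.
have f1 z : (z <= Z.of_nat m)%ZZ -> f z = sval s z.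
  by rewrite /f; case: Z.leb_spec => //; lia.
have f2 z : (0 <= z)%ZZ -> f (Z.of_nat m + z)%ZZ = sval s' z.
  move=> z0; rewrite /f; case: Z.leb_spec => zm; last by congr (sval s'); lia.
  have -> : z = 0%ZZ by lia.
  by rewrite Z.add_0_r.
have pf i : C (f i) (f (i + 1)%ZZ).
  case: (Z.lt_ge_cases i (Z.of_nat m)) => im.
    by rewrite !f1; [apply: (proj2_sig s)| |]; lia.
  have -> : i = (Z.of_nat m + (i - Z.of_nat m))%ZZ by lia.
  have -> : (Z.of_nat m + (i - Z.of_nat m) + 1 = Z.of_nat m + (i - Z.of_nat m + 1))%ZZ by lia.
  by rewrite !f2; [apply: (proj2_sig s')| |]; lia.
by exists (exist (fun s : Z -> S => forall i : Z, C (s i) (s (i + 1)%ZZ)) f pf); split.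
Qed.

(** A constant family [e] gives periodic points, a varying one prescribed rotation vectors. *)
Lemma concat_blocks (L : nat) (i : S) (e : Z -> Sg) : 0 < L ->
  (forall q, state_at (e q) 0 = i) -> (forall q, state_at (e q) L = i) ->
  exists t : Sg, forall (q : Z) (r : nat), r <= L ->
    sval t (q * Z.of_nat L + Z.of_nat r)%ZZ = state_at (e q) r.
Proof.
move=> L0 e0 eL; pose l := Z.of_nat L.
have l0 : (0 < l)%ZZ by rewrite /l; lia.
pose f z := sval (e (z / l)%ZZ) (z mod l)%ZZ.
have ff q r : r <= L -> f (q * l + Z.of_nat r)%ZZ = state_at (e q) r.
  rewrite leq_eqVlt => /orP[/eqP->|rL]; last first.
    rewrite /f Z.add_comm Z.div_add ?Z.div_small ?Z_mod_plus_full ?Z.mod_small; try lia.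
    by rewrite /state_at; congr (sval _ _); lia.
  rewrite /f (_ : (q * l + Z.of_nat L = 0 + (q + 1) * l)%ZZ); last by rewrite /l; lia.
  rewrite Z.div_add ?Z_mod_plus_full ?Z.div_small ?Z.mod_small; try lia.
  by rewrite eL; apply: e0.
have pf z : C (f z) (f (z + 1)%ZZ).
  have dm : z = ((z / l) * l + Z.of_nat (Z.to_nat (z mod l)))%ZZ.
    by rewrite Z2Nat.id; have := Z.div_mod z l; have := Z.mod_pos_bound z l; lia.
  have rL : Z.to_nat (z mod l) < L by have := Z.mod_pos_bound z l; lia.
  set q := (z / l)%ZZ in dm; set r := Z.to_nat _ in dm rL.
  rewrite dm (_ : (q * l + Z.of_nat r + 1 = q * l + Z.of_nat r.+1)%ZZ); last lia.
  rewrite !ff //; last exact: ltnW.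
  rewrite /state_at (_ : Z.of_nat r.+1 = Z.of_nat r + 1)%ZZ; last lia.
  exact: (proj2_sig (e q)).
by exists (exist (fun s : Z -> S => forall i : Z, C (s i) (s (i + 1)%ZZ)) f pf).
Qed.

End Shift.

(** * Paths and heights *)

Section Displacement.
Import Order.TTheory GRing.Theory Num.Theory.
Local Open Scope ring_scope.
Variables (S : finType) (C : S -> S -> bool) (d : nat) (A : 'M[int]_d).
Variable hh : S -> S -> 'cV[int]_d.
Notation Sg := (Sig C).
Notation V := 'cV[int]_d.
Notation tauA := (tau (C := C) A hh).
Notation sh := (@sshift S C).

(** The twisted cocycle: by [iter_tau], tau^m acts on the fibre over [s] as g -> A^m g +
    [disp m s]. *)
Definition disp (m : nat) (s : Sg) : V := (iter m tauA (s, 0)).2.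

Lemma iter_tau1 m x : (iter m tauA x).1 = iter m sh x.1.
Proof. by elim: m => //= m ->. Qed.

Lemma mulmxXS m (x : V) : A ^+ m.+1 *m x = A *m (A ^+ m *m x).
Proof. by rewrite exprS -mulmxE mulmxA. Qed.

Lemma mulmxXD m n (x : V) : A ^+ (m + n) *m x = A ^+ m *m (A ^+ n *m x).
Proof. by rewrite exprD -mulmxE mulmxA. Qed.

Lemma mulmxX0 (x : V) : A ^+ 0 *m x = x.
Proof. by rewrite expr0 mul1mx. Qed.

Lemma iter_tau m s g : iter m tauA (s, g) = (iter m sh s, A ^+ m *m g + disp m s).
Proof.
elim: m => [|m IHm]; first by rewrite /disp /= mulmxX0 addr0.
rewrite /disp !iterS IHm /tau /= !iter_tau1 /= mulmxDr mulmxXS -!addrA.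
by congr (_, _ + (_ + _)).
Qed.

Lemma dispS m s : disp m.+1 s = A *m disp m s + hh (state_at s m) (state_at s m.+1).
Proof.
rewrite /disp iterS /tau /= iter_tau1 /=; congr (_ + hh _ _);
  by rewrite sval_iter_shift; congr (sval s); lia.
Qed.

Lemma disp0 s : disp 0 s = 0. Proof. by []. Qed.

Lemma dispD m n s : disp (m + n) s = A ^+ n *m disp m s + disp n (iter m sh s).
Proof. by rewrite {1}/disp addnC iterD iter_tau [in LHS]iter_tau mulmx0 add0r. Qed.

Lemma eq_disp m s s' : (forall k, (k <= m)%N -> state_at s k = state_at s' k) ->
  disp m s = disp m s'.
Proof.
elim: m => [//|m IHm] ess; rewrite !dispS IHm ?ess //.
by move=> k km; apply: ess; apply: leqW.
Qed.

Hypothesis Aunit : A \in unitmx.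

Lemma mulmxX_surj m (y : V) : exists x, A ^+ m *m x = y.
Proof.
elim: m y => [|m IHm] y; first by exists y; rewrite mulmxX0.
have [x xE] := IHm (invmx A *m y).
by exists x; rewrite mulmxXS xE mulKVmx.
Qed.

Lemma tau_surj m x : exists y, iter m tauA y = x.
Proof.
case: x => s g; pose s' := shiftZ (- Z.of_nat m) s.
have [g' g'E] := mulmxX_surj m (g - disp m s').
exists (s', g'); rewrite iter_tau g'E subrK; congr (_, _).
by apply: sig_ext => z; rewrite sval_iter_shift sval_shiftZ; congr (sval s); lia.
Qed.

End Displacement.

Section Paths.
Import Order.TTheory GRing.Theory Num.Theory.
Local Open Scope ring_scope.
Variables (S : finType) (C : S -> S -> bool) (d : nat) (A : 'M[int]_d).
Variable hh : S -> S -> 'cV[int]_d.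
Notation Sg := (Sig C).
Notation V := 'cV[int]_d.
Notation tauA := (tau (C := C) A hh).
Notation sh := (@sshift S C).
Notation disp := (disp (C := C) A hh).

(** [C] may have states that lie on no two-sided sequence; these must be excluded. *)
Definition live (i : S) := exists s : Sg, state_at s 0 = i.

Lemma live_state (s : Sg) n : live (state_at s n).
Proof. by exists (iter n sh s); rewrite state_iter_shift addn0. Qed.

(** [W] is the precision of heights: the zero subgroup gives true orbits, larger subgroups give
    orbits in quotients. *)
Definition reach (W : V -> Prop) (m : nat) (i : S) (g : V) (j : S) (g' : V) :=
  exists s : Sg, state_at s 0 = i /\ state_at s m = j /\ W (A ^+ m *m g + disp m s - g').

Lemma glue_states (s s' : Sg) m : state_at s m = state_at s' 0 ->
  exists t : Sg, (forall k, (k <= m)%N -> state_at t k = state_at s k) /\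
    (forall k, state_at t (m + k)%N = state_at s' k).
Proof.
move=> /glue[t [t1 t2]]; exists t; split=> k => [km|].
  by rewrite /state_at t1 //; lia.
by rewrite /state_at -t2; [congr (sval t); lia|lia].
Qed.

Lemma glue_disp (s s' t : Sg) m n :
  (forall k, (k <= m)%N -> state_at t k = state_at s k) ->
  (forall k, state_at t (m + k)%N = state_at s' k) ->
  disp (m + n) t = A ^+ n *m disp m s + disp n s'.
Proof.
move=> t1 t2; rewrite dispD; congr (_ *m _ + _); apply: eq_disp => k km.
  by rewrite t1.
by rewrite state_iter_shift.
Qed.

Lemma reach_comp W m n i g j g' l g'' : is_subgroup W ->
  (forall x, W x -> W (A ^+ n *m x)) ->
  reach W m i g j g' -> reach W n j g' l g'' -> reach W (m + n) i g l g''.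
Proof.
move=> Wg Wn [s [s0 [sm sW]]] [s' [s'0 [s'n s'W]]].
have [|t [t1 t2]] := @glue_states s s' m; first by rewrite sm.
exists t; split; first by rewrite t1.
split; first by rewrite t2.
rewrite (glue_disp _ t1 t2) addnC mulmxXD.
have := subgroupD Wg (Wn _ sW) s'W; congr (W _).
by rewrite !mulmxDr mulmxN; zmod.
Qed.

Lemma reach0 W i g : is_subgroup W -> live i -> reach W 0 i g i g.
Proof.
move=> Wg [s s0]; exists s; split=> //; split=> //.
by rewrite mulmxX0 disp0 addr0 subrr; apply: subgroup0.
Qed.

Lemma reach_path W m s g : is_subgroup W ->
  reach W m (state_at s 0) g (state_at s m) (A ^+ m *m g + disp m s).
Proof. by move=> Wg; exists s; rewrite subrr; do !split; apply: subgroup0. Qed.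

Lemma reach_end W m i g j g' g'' : is_subgroup W -> W (g' - g'') ->
  reach W m i g j g' -> reach W m i g j g''.
Proof.
move=> Wg w [s [s0 [sm sW]]]; exists s; do !split=> //.
by have := subgroupD Wg sW w; rewrite addrA addrNK.
Qed.

Lemma reach_shift W m i g j g' z z' : is_subgroup W -> W (A ^+ m *m z - z') ->
  reach W m i g j g' -> reach W m i (g + z) j (g' + z').
Proof.
move=> Wg w [s [s0 [sm sW]]]; exists s; do !split=> //.
have := subgroupD Wg sW w; congr (W _).
by rewrite mulmxDr; zmod.
Qed.

(** Only coordinates 0 to [c] are fixed, which is what forward paths see; fixing the height modulo
    [G] makes the set saturated. *)
Definition cyl (G : V -> Prop) (s : Sg) (g : V) (c : nat) (x : Sg * V) :=
  (forall z, (z <= c)%N -> state_at x.1 z = state_at s z) /\ G (x.2 - g).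

Lemma cyl_open G s g c : prod_open (cyl G s g c).
Proof.
move=> x [x1 x2]; exists c => y y2 yx; split=> [z zc|]; last by rewrite y2.
by rewrite -x1 // /state_at yx //; lia.
Qed.

Lemma cyl_sat G s g c : is_subgroup G -> saturated (modrel G) (cyl G s g c).
Proof.
move=> Gg [x1 x2] [y1 y2] [/= e h] [/= h1 h2]; split=> /=; first by rewrite -e.
by have := subgroupB Gg h2 h; congr (G _); zmod.
Qed.

Lemma cyl_self G s g c : is_subgroup G -> cyl G s g c (s, g).
Proof. by move=> Gg; split=> //=; rewrite subrr; apply: subgroup0. Qed.

Lemma iter_tau_open k U : prod_open U -> prod_open (fun x => U (iter k tauA x)).
Proof.
move=> oU x Ux; have [n nP] := oU _ Ux; exists (n + k)%N => y y2 yx; apply: nP.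
  rewrite (surjective_pairing x) (surjective_pairing y) !iter_tau /= y2.
  congr (_ + _); apply: eq_disp => l lk; rewrite /state_at yx //; lia.
by move=> i ni; rewrite !iter_tau1 !sval_iter_shift yx //; lia.
Qed.

Lemma stableX (G : V -> Prop) : (forall x, G x -> G (A *m x)) ->
  forall m x, G x -> G (A ^+ m *m x).
Proof.
move=> GA; elim=> [|m IHm] x Gx; first by rewrite mulmxX0.
by rewrite mulmxXS; apply: GA; apply: IHm.
Qed.

Hypothesis Aunit : A \in unitmx.

(* Taking the preimage of the cylinder under the k-th iterate as target and
   moving with the 2k-th iterate, every meeting time is an odd multiple of k:
   this excludes the trivial meeting at time 0. *)
Lemma nonwandering (G : V -> Prop) k (s : Sg) (g : V) c :
  is_subgroup G -> (forall x, G x -> G (A *m x)) ->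
  transitive_mod (@prod_open S C d) (@modrel S C d G) (iter (2 * k) tauA) ->
  exists (n : nat) (t : Sg), (0 < n)%N /\ (forall z, (z <= c)%N -> state_at t z = state_at s z) /\
    (forall z, (z <= c)%N -> state_at t (n * k + z)%N = state_at s z) /\
    G (A ^+ (n * k) *m g + disp (n * k) t - g).
Proof.
move=> Gg GA tr; set U := cyl G s g c.
have oU : prod_open U := @cyl_open G s g c.
pose U' x := U (iter k tauA x).
have sU : saturated (modrel G) U by apply: cyl_sat.
have sU' : saturated (modrel G) U'.
  move=> [x1 x2] [y1 y2] [/= <- h] Ux; rewrite /U' in Ux *.
  apply: sU Ux; rewrite !iter_tau; split=> //=.
  rewrite opprD addrACA subrr addr0 -mulmxBr.
  exact: stableX.
have neU : nonempty U by exists (s, g); apply: cyl_self.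
have neU' : nonempty U'.
  by have [y yE] := tau_surj hh Aunit k (s, g); exists y; rewrite /U' yE; apply: cyl_self.
have odd_return : exists n x, [/\ (0 < n)%N, U x & U (iter (n * k) tauA x)].
  have [n [[x [Ux U'x]]|[x [U'x Ux]]]] := tr _ _ oU (@iter_tau_open k _ oU) sU sU' neU neU'.
    exists (n * 2).+1, x; split=> //; move: U'x; rewrite /U' -iterM -iterD.
    by congr (U (iter _ _ _)); lia.
  (* At time 0 the point lies in both [U] and [U'], which is a return after [k] steps. *)
  case: n Ux => [|n] Ux; first by exists 1%N, x; split=> //; rewrite mul1n.
  exists (n * 2).+1, (iter k tauA x); split=> //.
  move: Ux; rewrite -iterM -iterD; congr (U (iter _ _ _)); lia.
have [n [[t g'] [n0 [/= tc gc] [nc nG]]]] := odd_return.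
move: nc nG; rewrite iter_tau /= => nc nG.
exists n, t; split=> //; split=> //; split=> [z zc|].
  by rewrite -nc // state_iter_shift.
have := subgroupB Gg nG (stableX GA (n * k) gc); congr (G _).
by rewrite mulmxBr; zmod.
Qed.

(* Between states, transitivity in the two-sided sense yields a path in one
   direction only; a return of the cylinder of that path reverses it. *)
Lemma transitive_reach (G : V -> Prop) : is_subgroup G -> (forall x, G x -> G (A *m x)) ->
  (forall k, (0 < k)%N -> transitive_mod (@prod_open S C d) (@modrel S C d G) (iter k tauA)) ->
  forall K i g j g', (0 < K)%N -> live i -> live j ->
  exists m, reach G (K * m) i g j g'.
Proof.
move=> Gg GA tr K i g j g' K0 [s s0] [s' s'0].
have [||||n [[x [[x1 x2] [x3 x4]]]|[x [[x1 x2] [x3 x4]]]]] :=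
  tr K K0 _ _ (@cyl_open G s g 0) (@cyl_open G s' g' 0).
- exact: cyl_sat.
- exact: cyl_sat.
- by exists (s, g); apply: cyl_self.
- by exists (s', g'); apply: cyl_self.
- exists n, x.1; rewrite x1 //; split=> //; move: x3 x4.
  rewrite -iterM mulnC [x in iter _ _ x]surjective_pairing iter_tau => /= x3 x4.
  rewrite -[(K * n)%N]addn0 -state_iter_shift x3 // addn0; split=> //.
  have := subgroupB Gg x4 (stableX GA (K * n) x2); congr (G _).
  by rewrite mulmxBr; zmod.
set m := (n * K)%N.
move: x3 x4; rewrite -iterM -/m [x in iter _ _ x]surjective_pairing iter_tau /= => x3 x4.
have r1 : reach G m j g' i g.
  exists x.1; rewrite x1 // s'0; split=> //; split.
    by rewrite -[m]addn0 -state_iter_shift x3.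
  have := subgroupB Gg x4 (stableX GA m x2); congr (G _).
  by rewrite mulmxBr; zmod.
have [m0|m0] := posnP m.
  move: r1; rewrite m0 => -[t [t0 [t1 t2]]]; exists 0%N, t; rewrite muln0 t1.
  rewrite -t0 t1; split=> //; split=> //.
  by have := subgroupN Gg t2; rewrite !mulmxX0 disp0 !addr0 opprB.
case: r1 => t [t0 [t1 t2]].
have [|n' [u [n'0 [u1 [u2 u3]]]]] := @nonwandering G m t g' m Gg GA.
  by apply: tr; rewrite muln_gt0.
(* The return takes n' m steps with m = n K; what follows the first m of them leads from j back to
   i. *)
exists (n * n'.-1)%N, (iter m sh u).
have e1 : (K * (n * n'.-1) + m = n' * m)%N.
  by case: n' n'0 {u1 u2 u3} => // n' _; rewrite /m /=; lia.
have e2 : (n' * m = m + K * (n * n'.-1))%N by rewrite -e1 addnC.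
rewrite !state_iter_shift addn0 u1 // t1; split=> //.
rewrite -e2 -[(n' * m)%N]addn0 u2 // t0; split=> //.
have dE : disp m u = disp m t by apply: eq_disp.
move: u3; rewrite e2 dispD dE addnC mulmxXD => u3.
have := subgroupB Gg u3 (stableX GA (K * (n * n'.-1)) t2); congr (G _).
by rewrite mulmxBr !mulmxDr; zmod.
Qed.

End Paths.

(** * From symmetric to transitive reachability *)

Section Lattices.
Import Order.TTheory GRing.Theory Num.Theory.
Local Open Scope ring_scope.
Variables (d : nat).
Notation V := 'cV[int]_d.

Lemma ex_multiple (n : nat) (x : V) :
  (forall a, (n %| x a 0%R)%Z) -> exists v, x = n%:Z *: v.
Proof.
move=> nx; exists (\col_a (x a 0%R %/ n)%Z); apply/colP => a.
by rewrite !mxE mulrC divzK.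
Qed.

Lemma ex_multiple_mx (n : nat) (M : 'M[int]_d) :
  (forall a b, (n %| M a b)%Z) -> exists U, M = n%:Z *: U.
Proof.
move=> nx; exists (\matrix_(a, b) (M a b %/ n)%Z); apply/matrixP => a b.
by rewrite !mxE mulrC divzK.
Qed.

(** There are finitely many matrices modulo n, so two powers of [A] agree there, and the smaller one
    cancels. *)
Lemma power_eq1_mod (A : 'M[int]_d) (n : nat) : A \in unitmx -> (1 < n)%N ->
  exists (e : nat) (U : 'M[int]_d), (0 < e)%N /\ A ^+ e = 1 + n%:Z *: U.
Proof.
move=> Au n1; case: n n1 => // n n1.
pose f k : {ffun 'I_d * 'I_d -> 'I_n.+1} :=
  [ffun p => inord (absz ((A ^+ k) p.1 p.2 %% n.+1)%Z)].
have [a [b [ab fab]]] := pigeonhole f.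
have eqmod p q : ((A ^+ a) p q = (A ^+ b) p q %[mod n.+1])%Z.
  have /ffunP/(_ (p, q)) := fab; rewrite !ffunE /= => /(congr1 val).
  have lt z : (`|(z %% n.+1)%Z| < n.+1)%N.
    by rewrite -ltz_nat gez0_abs ?modz_ge0 // ltz_pmod.
  rewrite /= !inordK // => /(congr1 Posz).
  by rewrite !gez0_abs ?modz_ge0.
have [|U UE] := @ex_multiple_mx n.+1 (A ^+ b - A ^+ a).
  by move=> p q; rewrite addmx_entry oppmx_entry -eqz_mod_dvd; apply/eqP.
exists (b - a)%N, ((invmx A) ^+ a *m U); split; first by rewrite subn_gt0.
have AV : (invmx A) ^+ a *m A ^+ a = 1.
  elim: (a) => [|m IHm]; first by rewrite !expr0 mulmx1.
  by rewrite exprSr exprS -!mulmxE -mulmxA [invmx A *m _]mulmxA mulVmx // mul1mx.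
rewrite scalemxAr -UE mulmxBr AV addrC subrK -(subnKC (ltnW ab)) exprD addKn.
by rewrite -mulmxE mulmxA AV mul1mx.
Qed.

(* If Lam + 2 Z^d = Z^d, then Lam contains the columns of a matrix of odd
   determinant D, hence D Z^d, and Lam + 2D Z^d = Z^d concludes. *)
Lemma subgroup_full (Lam : V -> Prop) : is_subgroup Lam ->
  (forall n : nat, (1 < n)%N -> forall g, exists v, Lam (g - n%:Z *: v)) ->
  forall g, Lam g.
Proof.
move=> Lg full g.
have /fin_all_exists[v vP] : forall j : 'I_d, exists v, Lam (delta_mx j 0 - 2%:Z *: v).
  by move=> j; apply: full.
pose L : 'M[int]_d := \matrix_(a, b) (delta_mx b 0 - 2%:Z *: v b) a (0 : 'I_1).
have LP x : Lam (L *m x).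
  have -> : L *m x = \sum_j x j 0 *: (delta_mx j 0 - 2%:Z *: v j).
    apply/colP => a; rewrite mxE summxE; apply: eq_bigr => j _.
    by rewrite mxE scalemx_entry mulrC.
  by apply: subgroup_sum => // j; apply: subgroupZ.
have D0 : \det L != 0.
  apply: contraTneq isT => D0.
  pose f := (intr : int -> 'F_2).
  have : \det (map_mx f L) = f 0 by rewrite det_map_mx D0.
  have -> : map_mx f L = 1%:M.
    apply/matrixP => a b; rewrite !mxE /f rmorphB rmorphM /=.
    have -> : (2%:Z%:~R : 'F_2) = 0 by apply/val_inj.
    by rewrite mul0r subr0 andbT; case: (a == b).
  by rewrite det1 /f rmorph0 => /eqP; rewrite oner_eq0.
have DP x : Lam (\det L *: x).
  by have := LP (\adj L *m x); rewrite mulmxA mul_mx_adj mul_scalar_mx.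
have [|w wP] := full (2 * `|\det L|)%N _ g.
  by move: D0; rewrite -absz_gt0; lia.
rewrite -(subrK ((2 * `|\det L|)%N%:Z *: w) g); apply: subgroupD => //.
rewrite PoszM -scalerA; apply: subgroupZ => //.
by rewrite abszE; case: (ger0P (\det L)) => _ //; rewrite scaleNr; apply: subgroupN.
Qed.

Lemma finite_index_multiples (n : nat) (G : V -> Prop) : (0 < n)%N ->
  is_subgroup G -> (forall v, G (n%:Z *: v)) -> finite_index G.
Proof.
case: n => // n _ Gg Gn.
exists [seq (\col_a (f a : nat)%:Z : V) | f : {ffun 'I_d -> 'I_n.+1}] => g.
pose f : {ffun 'I_d -> 'I_n.+1} := [ffun a => inord `|(g a 0%R %% n.+1)%Z|].
exists (\col_a (f a : nat)%:Z); first by apply/imageP; exists f.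
have [|v ->] := @ex_multiple n.+1 (g - \col_a (f a : nat)%:Z); last exact: Gn.
move=> a; rewrite addmx_entry oppmx_entry mxE ffunE inordK.
  rewrite gez0_abs ?modz_ge0 // -eqz_mod_dvd modz_mod.
  exact: eqxx.
by rewrite -ltz_nat gez0_abs ?modz_ge0 // ltz_pmod.
Qed.

End Lattices.

Section Loops.
Import Order.TTheory GRing.Theory Num.Theory.
Local Open Scope ring_scope.
Variables (S : finType) (C : S -> S -> bool) (d : nat) (A : 'M[int]_d).
Variable hh : S -> S -> 'cV[int]_d.
Notation Sg := (Sig C).
Notation V := 'cV[int]_d.
Notation disp := (@disp S C d A hh).
Notation reach := (@reach S C d A hh).
Hypothesis Aunit : A \in unitmx.

(** The ftp for the subgroup Z^d itself is transitivity of the powers of the base shift. Prefixing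
    [K] steps of a point makes the length positive. *)
Lemma ftp_base_path : @total_ftp S C d A hh -> forall K i j, (0 < K)%N ->
  live C i -> live C j ->
  exists m (s : Sg), (0 < m)%N /\ state_at s 0 = i /\ state_at s (K * m) = j.
Proof.
move=> ft K i j K0 [s s0] lj; pose T (_ : V) := True.
have Tg : is_subgroup T by [].
have [|||||m [t [t0 [t1 _]]]] := @transitive_reach S C d A hh Aunit T Tg _ _ K (state_at s K) 0 j 0.
- by [].
- move=> k k0; apply: (ft k k0 T Tg) => //.
  by exists [:: 0] => g; exists 0; rewrite ?inE.
- by [].
- exact: live_state.
- exact: lj.
have [u [u1 u2]] := glue_states (esym t0).
exists m.+1, u; split=> //; split; first by rewrite u1.
by rewrite mulnS u2.
Qed.

Section AtState.
Variables (K : nat) (i : S) (W : V -> Prop).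
Hypotheses (K0 : (0 < K)%N) (li : live C i) (Wg : is_subgroup W).
Hypothesis WK : forall x, W x -> W (A ^+ K *m x).

Definition orb (g g' : V) := exists m, reach W (K * m) i g i g'.

Lemma stableKX m x : W x -> W (A ^+ (K * m) *m x).
Proof. by rewrite exprM; move: m x; apply: stableX. Qed.

Lemma orb_refl g : orb g g.
Proof. by exists 0%N; rewrite muln0; apply: reach0. Qed.

Lemma orb_trans g1 g2 g3 : orb g1 g2 -> orb g2 g3 -> orb g1 g3.
Proof.
move=> [m1 r1] [m2 r2]; exists (m1 + m2)%N; rewrite mulnDr.
by apply: reach_comp r1 r2 => // x; apply: stableKX.
Qed.

Lemma orb_loop (s : Sg) m g : state_at s 0 = i -> state_at s (K * m) = i ->
  orb g (A ^+ (K * m) *m g + disp (K * m) s).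
Proof. by move=> s0 sm; exists m; rewrite -{1}s0 -sm; apply: reach_path. Qed.

Lemma loop_repeat (s : Sg) (L n : nat) (U : 'M[int]_d) r : state_at s 0 = i -> state_at s L = i ->
  A ^+ L = 1 + n%:Z *: U ->
  exists (t : Sg) v, state_at t 0 = i /\ state_at t (L * r) = i /\
    disp (L * r) t = disp L s *+ r + n%:Z *: v.
Proof.
move=> s0 sL AL; elim: r => [|r [t [v [t0 [tr tv]]]]].
  by exists s, 0; rewrite !muln0 disp0 mulr0n scaler0 addr0.
have [|u [u1 u2]] := @glue_states S C t s (L * r); first by rewrite tr.
exists u, (v + U *m disp (L * r) t); rewrite mulnS addnC u1 // u2; do !split=> //.
rewrite (glue_disp A hh _ u1 u2) AL mulmxDl mul1mx -scalemxAl {1}tv mulrSr.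
by zmod.
Qed.

(* Lam collects the translations which stay inside the classes of orb; it
   contains the difference of the displacements of two loops of equal length.
   Comparing a loop with a suitable repetition of a fixed one gives
   Lam + n Z^d = Z^d for all n. *)
Lemma symmetric_orb_transitive : @total_ftp S C d A hh ->
  (forall g g', orb g g' -> orb g' g) -> forall g g', orb g g'.
Proof.
move=> ft sym; pose Lam (t : V) := forall g, orb g (g + t).
have Lg : is_subgroup Lam.
  split=> [g|t t' Lt Lt' g]; first by rewrite addr0; apply: orb_refl.
  apply: orb_trans (Lt g) _; apply: sym.
  by have := Lt' (g + (t - t')); rewrite -addrA subrK.
have Lam_diff m (s s' : Sg) : state_at s 0 = i -> state_at s (K * m) = i ->
    state_at s' 0 = i -> state_at s' (K * m) = i ->
    Lam (disp (K * m) s - disp (K * m) s').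
  move=> s0 sm s'0 s'm g.
  have [x xE] := mulmxX_surj Aunit (K * m) (g - disp (K * m) s').
  have o1 := orb_loop x s0 sm; have o2 := orb_loop x s'0 s'm.
  move: o1 o2; rewrite xE subrK => o1 o2; apply: orb_trans (sym _ _ o2) _.
  by rewrite addrA addrAC.
suff Lfull g : Lam g by move=> g g'; have := Lfull (g' - g) g; rewrite addrC subrK.
apply: (subgroup_full Lg) => n n1 {}g.
have [e [U [e0 Ae]]] := power_eq1_mod Aunit n1.
have Ae' r : exists U : 'M[int]_d, A ^+ (e * r) = 1 + n%:Z *: U.
  elim: r => [|r [U' U'E]]; first by exists 0; rewrite muln0 scaler0 addr0.
  exists (U + A ^+ e *m U'); rewrite mulnS exprD U'E mulrDr mulr1 {1}Ae -!mulmxE.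
  by rewrite -scalemxAr -addrA -scalerDr.
have [|m1 [s1 [m10 [s10 s1L]]]] := ftp_base_path ft (K := K * e) _ li li.
  by rewrite muln_gt0 K0.
(* Divisible by [K], so that loops of length L count for [orb], and by [e], so that A^L = 1 modulo
   n. *)
set L := (K * e * m1)%N in s1L.
have L0 : (0 < L)%N by rewrite !muln_gt0 K0 e0.
have LE r : (L * r = e * (K * m1 * r))%N by rewrite /L; lia.
have LE' r : (L * r = K * (e * m1 * r))%N by rewrite /L; lia.
have [U1 U1E] : exists U : 'M[int]_d, A ^+ L = 1 + n%:Z *: U.
  by rewrite -[L]muln1 LE; apply: Ae'.
pose Gam (x : V) := exists v : V, Lam (x - n%:Z *: v).
have Gg : is_subgroup Gam.
  split; first by exists 0; rewrite scaler0 subr0; apply: subgroup0.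
  move=> x y [v xv] [w yw]; exists (v - w).
  by have := subgroupB Lg xv yw; congr Lam; zmod.
have Gn v : Gam (n%:Z *: v) by exists v; rewrite subrr; apply: subgroup0.
have GL x : Lam x -> Gam x by exists 0; rewrite scaler0 subr0.
have mvG r x : Gam (A ^+ (L * r) *m x - x).
  rewrite LE; have [U2 ->] := Ae' (K * m1 * r)%N.
  by rewrite mulmxDl mul1mx -scalemxAl addrAC subrr add0r.
(* The comparison loop repeats [s1] a multiple of n times, so its displacement vanishes modulo n. *)
have Gloop r (w : Sg) : state_at w 0 = i -> state_at w (L * (n * r)) = i ->
    Gam (disp (L * (n * r)) w).
  move=> w0 wL.
  have [t [v [t0 [tL tE]]]] := loop_repeat (n * r) s10 s1L U1E.
  rewrite -[disp _ w](subrK (disp (L * (n * r)) t)); apply: subgroupD => //.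
    by apply: GL; move: wL tL; rewrite LE' => wL tL; apply: Lam_diff.
  rewrite tE mulrnA; apply: subgroupD => //.
  have -> : disp L s1 *+ n *+ r = n%:Z *: (disp L s1 *+ r).
    by rewrite -mulrnA mulnC mulrnA -scaler_nat natz.
  exact: Gn.
change (Gam g).
have Ginv : mx_invariant (A ^+ (L * n)) Gam.
  move=> x; split=> Gx.
    by rewrite -(subrK x (_ *m _)); apply: subgroupD.
  by have := subgroupB Gg Gx (mvG n x); congr Gam; zmod.
have Ln0 : (0 < L * n)%N by rewrite muln_gt0 L0; apply: ltnW.
have [s0 s00] := li.
(* Transitivity modulo [Gam] joins height 0 to height g by a loop, in one direction or the other; by
   [Gloop] and [mvG] its total height change lies in [Gam], hence so does g. *)
have [|||||r [] [x [[x1 x2] x34]]] := ft _ Ln0 Gam Gg _ Ginv _ _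
    (@cyl_open S C d Gam s0 0 0) (@cyl_open S C d Gam s0 g 0).
- by apply: (@finite_index_multiples _ n) => //; apply: ltnW.
- exact: cyl_sat.
- exact: cyl_sat.
- by exists (s0, 0); apply: cyl_self.
- by exists (s0, g); apply: cyl_self.
- move: x34; rewrite -iterM (surjective_pairing x) iter_tau mulnC -mulnA => -[/= y1 y2].
  move: (y1 0%N isT); rewrite state_iter_shift addn0 s00 => yL.
  have := Gloop r x.1; rewrite x1 // => /(_ s00 yL) Gd.
  have := subgroupB Gg (subgroupD Gg (subgroupD Gg Gd (mvG (n * r)%N x.2)) x2) y2.
  by congr Gam; zmod.
- move: x34; rewrite -iterM (surjective_pairing x) iter_tau mulnC -mulnA => -[/= y1 y2].
  move: (y1 0%N isT); rewrite state_iter_shift addn0 s00 => yL.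
  have := Gloop r x.1; rewrite x1 // => /(_ s00 yL) Gd.
  have := subgroupB Gg y2 (subgroupD Gg (subgroupD Gg Gd (mvG (n * r)%N x.2)) x2).
  by congr Gam; zmod.
Qed.

End AtState.
End Loops.

Section Lifting.
Import Order.TTheory GRing.Theory Num.Theory.
Local Open Scope ring_scope.
Variables (S : finType) (C : S -> S -> bool) (d : nat) (A : 'M[int]_d).
Variable hh : S -> S -> 'cV[int]_d.
Notation Sg := (Sig C).
Notation V := 'cV[int]_d.
Notation disp := (@disp S C d A hh).
Notation reach := (@reach S C d A hh).
Notation orb := (@orb S C d A hh).
Hypothesis Aunit : A \in unitmx.

Lemma orb_shift K i (W : V -> Prop) (z g g' : V) : is_subgroup W ->
  (forall m, W (A ^+ (K * m) *m z - z)) ->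
  orb K i W g g' -> orb K i W (g + z) (g' + z).
Proof. by move=> Wg Wz [m r]; exists m; apply: reach_shift. Qed.

Lemma orb_sub K i (W W' : V -> Prop) (g g' : V) : (forall x, W x -> W' x) ->
  orb K i W g g' -> orb K i W' g g'.
Proof.
by move=> WW [m [s [s0 [sm sW]]]]; exists m, s; do !split=> //; apply: WW.
Qed.

Lemma drift_sign (e f : int) (q : nat) : e = 1 \/ e = -1 -> (0 < q)%N ->
  1 <= e * (f + e * (`|f| + 1) * q%:Z).
Proof.
move=> ePM q0.
have h : `|f| + 1 <= (`|f| + 1) * q%:Z by apply: ler_peMr; [apply: addr_ge0|lia].
have fb : - `|f| <= e * f.
  by case: ePM => ->; rewrite ?mul1r ?mulN1r; case: (ger0P f); lia.
have -> : e * (f + e * (`|f| + 1) * q%:Z) = e * f + (`|f| + 1) * q%:Z.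
  by case: ePM => ->; ring.
lia.
Qed.

Lemma drift_dominates (e a c : int) : e = 1 \/ e = -1 -> 1 <= e * c ->
  0 < e * (a + c *+ (absz a).+1).
Proof.
move=> ePM ec.
have h : (absz a).+1%:Z <= (e * c) * (absz a).+1%:Z by apply: ler_peMl.
have ab : - (absz a)%:Z <= e * a.
  by case: ePM => ->; rewrite ?mul1r ?mulN1r abszE; case: (ger0P a); lia.
have -> : e * (a + c *+ (absz a).+1) = e * a + e * c * (absz a).+1%:Z.
  by rewrite -mulr_natr natz mulrDr mulrA.
lia.
Qed.

(** Shows that an additive semigroup of integers with elements of both signs is a group. *)
Lemma opp_combination (a b : int) : (0 < a /\ b < 0) \/ (a < 0 /\ 0 < b) ->
  - a = a *+ (absz b).-1 + b *+ absz a.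
Proof.
move=> ab; rewrite -[a *+ _]mulr_natr -[b *+ _]mulr_natr !natz.
have -> : (absz b).-1%:Z = (absz b)%:Z - 1 by lia.
by rewrite !abszE; case: ab => -[? ?];
  [rewrite (gtr0_norm (x := a)) // (ltr0_norm (x := b)) //
  |rewrite (ltr0_norm (x := a)) // (gtr0_norm (x := b)) //]; ring.
Qed.

Section Extension.
Variables (N k : nat) (i : S) (W : V -> Prop) (y z : V).
Hypotheses (N0 : (0 < N)%N) (k0 : (0 < k)%N) (li : live C i) (Wg : is_subgroup W).
Hypothesis WN : forall x, W x -> W (A ^+ N *m x).
Hypothesis zE : z = A ^+ N *m y - y.
Hypothesis Wz : W (A ^+ N *m z - z).

Let stableN q x : W x -> W (A ^+ (N * q) *m x).
Proof. by rewrite exprM; apply: stableX. Qed.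

Let zN q : W (A ^+ (N * q) *m z - z).
Proof.
elim: q => [|q IHq]; first by rewrite muln0 mulmxX0 subrr; apply: subgroup0.
have := subgroupD Wg (stableN q Wz) IHq; congr W.
by rewrite mulnS addnC mulmxXD mulmxBr; zmod.
Qed.

(** Source of the drift: [z] is fixed modulo [W], so translating by [y] contributes an amount of [z]
    linear in the length. *)
Let yN q : W (A ^+ (N * q) *m y - y - q%:Z *: z).
Proof.
elim: q => [|q IHq].
  by rewrite muln0 mulmxX0 subrr scale0r subr0; apply: subgroup0.
have := subgroupD Wg (WN IHq) (subgroupZ Wg q Wz); congr W.
have yE : A ^+ N *m y = z + y by rewrite zE subrK.
by rewrite mulnS mulmxXD !mulmxBr -!scalemxAr yE intS; zmod.
Qed.

(* A loop R taking g to g + f z modulo W, conjugated by the translation by a y,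
   takes g + a y to g + a y + (f + a q) z, where q > 0 is its length divided by
   N. Both signs of f + a q occur, so the multiples of z reachable from g form
   a group. *)
Lemma orb_extension_symmetric :
  (exists m (s : Sg), (0 < m)%N /\ state_at s 0 = i /\ state_at s (N * k * m) = i) ->
  (forall g g', orb (N * k) i (fun x => exists a : int, W (x - a *: z)) g g') ->
  forall g g', orb (N * k) i W g g' -> orb (N * k) i W g' g.
Proof.
set K := (N * k)%N => -[m0 [s0 [m00 [s00 s0m]]]] tr.
have WK x : W x -> W (A ^+ K *m x) by apply: stableN.
have zK m (a : int) : W (A ^+ (K * m) *m (a *: z) - a *: z).
  by rewrite -scalemxAr -scalerBr /K -mulnA; apply: subgroupZ.
have yK m (a : int) : W (A ^+ (K * m) *m (a *: y) - (a *: y + (a * (k * m)%N%:Z) *: z)).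
  have := subgroupZ Wg a (yN (k * m)); rewrite /K -mulnA -scalemxAr.
  by congr (W _); zmod.
have lift g g' : exists a : int, orb K i W g (g' + a *: z).
  have [m [s [s1 [sm [a aW]]]]] := tr g g'; exists a, m, s; do !split=> //.
  by rewrite opprD addrA.
pose otrans := @orb_trans S C d A hh K i W Wg WK.
have oshift g g' (a : int) : orb K i W g g' -> orb K i W (g + a *: z) (g' + a *: z).
  by apply: orb_shift => // m; apply: zK.
pose E g (a : int) := orb K i W g (g + a *: z).
have EMn g a p : E g a -> E g (a *+ p).
  move=> Ea; elim: p => [|p IHp].
    by rewrite /E mulr0n scale0r addr0; apply: orb_refl.
  apply: (otrans _ _ _ IHp); rewrite /E mulrS scalerDl addrA.
  exact: oshift.
have ED g a b : E g a -> E g b -> E g (a + b).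
  move=> Ea /(oshift _ _ a) Eb; apply: (otrans _ _ _ Ea).
  move: Eb; have -> : g + b *: z + a *: z = g + (a + b) *: z by zmod.
  by [].
have Epos g (e : int) : (e = 1 \/ e = -1) -> exists a, E g a /\ 0 < e * a.
  move=> ePM.
  have [f [M [M0 rM]]] : exists (f : int) (M : nat),
      (0 < M)%N /\ reach W (K * M) i g i (g + f *: z).
    have [f [m rm]] := lift (A ^+ (K * m0) *m g + disp (K * m0) s0) g.
    exists f, (m0 + m)%N; split; first by rewrite addn_gt0 m00.
    rewrite mulnDr; apply: reach_comp rm => //.
      by move=> x; apply: (@stableKX _ A).
    by rewrite -{1}s00 -s0m; apply: reach_path.
  pose q := (k * M)%N; have q0 : (0 < q)%N by rewrite muln_gt0 k0.
  pose s := e * (`|f| + 1); pose c := f + s * q%:Z.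
  have ec : 1 <= e * c by apply: drift_sign.
  have rc : E (g + s *: y) c.
    exists M; have -> : g + s *: y + c *: z = g + f *: z + (s *: y + (s * (k * M)%N%:Z) *: z).
      by rewrite /c /q; zmod.
    exact: reach_shift Wg (yK M s) rM.
  have [a oa] := lift g (g + s *: y); have [b ob] := lift (g + s *: y) g.
  (* Go to g + s y at cost [a], run the drifting loop often enough to outweigh a + b, and return at
     cost [b]. *)
  exists (a + b + c *+ (absz (a + b)).+1); split.
    have := EMn _ _ (absz (a + b)).+1 rc; set pc := c *+ _ => opc.
    apply: (otrans _ _ _ oa); apply: (otrans _ _ _ (oshift _ _ a opc)).
    have := oshift _ _ (a + pc) ob.
    have -> : g + s *: y + (a + pc) *: z = g + s *: y + pc *: z + a *: z by zmod.
    have -> : g + b *: z + (a + pc) *: z = g + (a + b + pc) *: z by zmod.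
    by [].
  exact: drift_dominates.
have EN g a : E g a -> E g (- a).
  case: (ltrgt0P a) => [a0|a0|->] Ea; last by rewrite oppr0.
    have [b [Eb b0]] := Epos g (-1) (or_intror erefl).
    by rewrite (@opp_combination a b); [apply: ED; apply: EMn|left; split=> //; lia].
  have [b [Eb b0]] := Epos g 1 (or_introl erefl).
  by rewrite (@opp_combination a b); [apply: ED; apply: EMn|right; split=> //; lia].
move=> g g' o; have [a oa] := lift g' g; apply: (otrans _ _ _ oa).
have /EN : E g a by apply: (otrans _ _ _ o oa).
by move/(oshift _ _ a); rewrite -addrA -scalerDl addNr scale0r addr0.
Qed.

End Extension.

End Lifting.

(** * Reachability from rotation vectors *)

Section Greedy.
Import Order.TTheory GRing.Theory Num.Theory.
Local Open Scope ring_scope.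
Variables (d k : nat) (P : 'M[int]_(k, d)) (E : 'cV[int]_d -> Prop) (u : 'cV[int]_d).

(* Always stepping into the orthant opposite to the current position keeps the
   walk in a box, so it revisits a point; each step contains a copy of u. *)
Lemma greedy_cancel : E 0 -> (forall x y, E x -> E y -> E (x + y)) -> E u ->
  (forall e : {ffun 'I_k -> bool}, exists x, E x /\ forall j,
     if e j then 0 < (P *m (u + x)) j 0 else (P *m (u + x)) j 0 < 0) ->
  exists v, E v /\ P *m (u + v) = 0.
Proof.
move=> E0 ED Eu /fin_all_exists[x xP].
pose D e := P *m (u + x e).
pose M := (\max_(e : {ffun 'I_k -> bool}) \max_(j < k) absz (D e j 0%R))%N.
have DM e j : (absz (D e j 0%R) <= M)%N.
  apply: leq_trans (leq_bigmax e).
  exact: (leq_bigmax (F := fun j : 'I_k => absz (D e j 0%R)) j).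
pose next (w : 'cV[int]_k) := w + D [ffun j => w j 0 < 0].
pose F a := iter a next 0.
have box a j : (absz (F a j 0%R) <= M)%N.
  elim: a => [|a IHa]; first by rewrite /F /= zeromx_entry.
  rewrite /F iterS -/(F a) /next addmx_entry.
  set e := [ffun _ => _]; have := DM e j; have [_ /(_ j)] := xP e.
  by rewrite -/(D e) /e ffunE -/e; move: (D e j 0) (F a j 0) IHa => p q; case: ifP; lia.
pose box_code a : {ffun 'I_k -> 'I_(2 * M).+1} := [ffun j => inord (absz (F a j 0%R + M%:Z))].
have [a [b [ab Fab]]] := pigeonhole box_code.
have {Fab} Fab : F a = F b.
  apply/colP => j; have /ffunP/(_ j) := Fab; rewrite !ffunE => /(congr1 val) /=.
  by have := box a j; have := box b j; move: (F a j 0) (F b j 0) => p q ? ?; rewrite !inordK; lia.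
have EMn w n : E w -> E (w *+ n).
  by move=> Ew; elim: n => [|n IHn]; rewrite ?mulr0n // mulrS; apply: ED.
have steps c w : exists e, E e /\ iter c next w = w + P *m (u *+ c + e).
  elim: c => [|c [e [Ee eE]]]; first by exists 0; rewrite mulr0n addr0 mulmx0 addr0.
  rewrite iterS eE /next; set f := [ffun _ => _].
  exists (e + x f); split; first by apply: ED => //; case: (xP f).
  rewrite -addrA; congr (_ + _); rewrite /D -mulmxDr; congr (_ *m _).
  by rewrite mulrSr -!addrA; congr (_ + _); rewrite addrCA.
have [e [Ee eE]] := steps (b - a)%N (F a).
(* The closed walk contains b - a copies of [u]; one is split off and the rest goes into the
   witness. *)
exists (u *+ (b - a).-1 + e); split; first by apply: ED => //; apply: EMn.
rewrite addrA -mulrS prednK ?subn_gt0 //.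
apply: (addrI (F a)); rewrite -eE /F -iterD subnK 1?ltnW // addr0.
exact: esym.
Qed.

End Greedy.

Section Purification.
Import Order.TTheory GRing.Theory Num.Theory.
Local Open Scope ring_scope.
Variables (d : nat).
Notation V := 'cV[int]_d.

(** The elements with a positive multiple in [G] form a pure subgroup containing [G]. *)
Lemma purification_multiple (G : V -> Prop) x : is_subgroup G ->
  purification G x -> exists n : nat, (0 < n)%N /\ G (x *+ n).
Proof.
move=> Gg pur; pose Q (x : V) := exists n : nat, (0 < n)%N /\ G (x *+ n).
apply: (pur Q).
- split; first by exists 1%N; rewrite mulr1n; split=> //; apply: subgroup0.
  move=> a b [n [n0 na]] [m [m0 mb]]; exists (n * m)%N; rewrite muln_gt0 n0 m0; split=> //.
  rewrite mulrnBl mulrnA mulnC mulrnA; apply: subgroupB => //; exact: subgroupMn.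
- move=> g n n0 [m [m0 mP]]; exists (absz n * m)%N; rewrite muln_gt0 m0 absz_gt0 n0; split=> //.
  rewrite mulrnA -[g *+ _]scaler_nat natz abszE.
  case: (ger0P n) => _ //.
  by rewrite scaleNr mulNrn; apply: subgroupN.
- by move=> y Gy; exists 1%N; rewrite mulr1n.
Qed.

End Purification.

Section RealInt.
Import Order.TTheory GRing.Theory Num.Theory.
Local Open Scope ring_scope.

Lemma int2R_opp z : int2R (- z) = Ropp (int2R z).
Proof.
case: z => [[|n]|n].
- by rewrite oppr0 /= Ropp_0.
- by rewrite /GRing.opp.
- by rewrite NegzE opprK /= Ropp_involutive.
Qed.

Lemma int2R_gt (B : nat) z : Rlt (INR B) (int2R z) -> B%:Z < z.
Proof.
case: z => n /=; first by move/INR_lt; lia.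
have := pos_INR B; have := pos_INR n; case: n => [|n] /= *; lra.
Qed.

(** Each sum divided by n is eventually within eps/2 of its limit, so the sum exceeds n eps/2 in the
    direction of that limit, hence any bound [B]. *)
Lemma rot_at_drift (S : Type) (C : S -> S -> bool) (k : nat) T (H : Sig C -> 'cV[int]_k) s
    (e : 'I_k -> bool) (eps : R) (B : nat) : Rlt 0 eps ->
  rot_at T H s (fun j => if e j then eps else Ropp eps) ->
  exists n0, forall j n, (n0 <= n)%N ->
    if e j then B%:Z < (\sum_(i < n) H (iter i T s)) j 0
    else (\sum_(i < n) H (iter i T s)) j 0 < - B%:Z.
Proof.
move=> eps0 rot; apply: fin_all_bound => [j m n mn mP p np|j].
  by apply: mP; apply: leq_trans np.
have e20 : Rlt 0 (eps / 2) by lra.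
have [N1 N1P] := rot j _ e20; have [N2 N2P] := INR_archimed _ (INR B) e20.
exists (N1 + N2).+1 => n nn.
have nR : Rle (INR N2) (INR n) by apply: le_INR; lia.
have n0 : Rlt 0 (INR n) by apply: lt_0_INR; lia.
have cancel r : Rmult (INR n) (Rdiv r (INR n)) = r.
  by rewrite /Rdiv -Rmult_assoc Rinv_r_simpl_m //; lra.
have := N1P n _; move: (\sum_(i < n) H (iter i T s)) => x.
rewrite /Rdist => /(_ ltac:(lia)) xP.
have Bn : Rlt (INR B) (INR n * (eps / 2)) by nra.
case: (e j) xP => xP.
  apply: int2R_gt; apply: (Rlt_trans _ _ _ Bn).
  have : Rlt (eps / 2) (int2R (x j 0) / INR n) by move: xP; split_Rabs; lra.
  by move=> /(Rmult_lt_compat_l _ _ _ n0); rewrite cancel.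
suff : B%:Z < - x j 0 by lia.
apply: int2R_gt; apply: (Rlt_trans _ _ _ Bn); rewrite int2R_opp.
have : Rlt (eps / 2) (- (int2R (x j 0) / INR n)) by move: xP; split_Rabs; lra.
by move=> /(Rmult_lt_compat_l _ _ _ n0); rewrite Ropp_mult_distr_r_reverse cancel.
Qed.
End RealInt.

Section Descent.
Import Order.TTheory GRing.Theory Num.Theory.
Local Open Scope ring_scope.
Variables (S : finType) (C : S -> S -> bool) (d : nat) (A : 'M[int]_d).
Variable hh : S -> S -> 'cV[int]_d.
Notation Sg := (Sig C).
Notation V := 'cV[int]_d.
Notation disp := (@disp S C d A hh).
Notation reach := (@reach S C d A hh).
Notation orb := (@orb S C d A hh).
Notation sh := (@sshift S C).
Hypothesis Aunit : A \in unitmx.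

(** Turns the sums defining rotation vectors of tau^N into heights of long paths. *)
Lemma untwisted_sum k (P : 'M[int]_(k, d)) N n s :
  (forall x : V, P *m (A ^+ N *m x) = P *m x) ->
  \sum_(a < n) P *m disp N (iter a (iter N sh) s) = P *m disp (N * n) s.
Proof.
move=> PA; elim: n => [|n IHn]; first by rewrite big_ord0 muln0 disp0 mulmx0.
by rewrite big_ord_recr /= IHn mulnS addnC dispD mulmxDr PA -iterM mulnC.
Qed.

Section Unipotent.
Variables (N : nat) (i : S).
Hypotheses (N0 : (0 < N)%N) (li : live C i).
Hypothesis ft : @total_ftp S C d A hh.
Let nil := A ^+ N - 1.
Let im (j : nat) (x : V) := exists u : V, x = nil ^+ j *m u.

Let imE (x : V) : A ^+ N *m x = x + nil *m x.
Proof. by rewrite /nil mulmxBl mul1mx addrCA subrr addr0. Qed.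

Let im_group j : is_subgroup (im j).
Proof.
split; first by exists 0; rewrite mulmx0.
by move=> x y [u ->] [v ->]; exists (u - v); rewrite mulmxBr.
Qed.

Let im1K m (x : V) : im 1 (A ^+ (N * m) *m x - x).
Proof.
elim: m => [|m IHm]; first by rewrite muln0 mulmxX0 subrr; apply: subgroup0.
rewrite mulnS addnC addnC mulmxXD imE.
rewrite addrAC; apply: subgroupD => //.
by exists (A ^+ (N * m) *m x); rewrite expr1.
Qed.

(* Modulo im nil the iterate tau^N is untwisted, and Z^k is the quotient by the
   purification of im nil. *)
Lemma rot_symmetric k0 : (0 < k0)%N -> @zero_in_int_rotF S C d A hh N ->
  forall g g', orb (N * k0) i (im 1) g g' -> orb (N * k0) i (im 1) g' g.
Proof.
move=> k00 [k [P [kpos [_ [Pker [eps [eps0 rotE]]]]]]].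
set K := (N * k0)%N; have K0 : (0 < K)%N by rewrite muln_gt0 N0.
have imK m (x : V) : im 1 (A ^+ (K * m) *m x - x) by rewrite /K -mulnA.
have im_st m x : im 1 x -> im 1 (A ^+ (K * m) *m x).
  by move=> ix; rewrite -(subrK x (_ *m _)); apply: subgroupD.
have im_stK x : im 1 x -> im 1 (A ^+ K *m x) by rewrite -[K]muln1; apply: im_st.
have PA (x : V) : P *m (A ^+ N *m x) = P *m x.
  apply/eqP; rewrite -subr_eq0 -mulmxBr; apply/eqP/Pker => G Gg Gp; apply.
  by exists x.
pose E t := orb K i (im 1) 0 t.
have Etr g g' t : orb K i (im 1) g g' -> orb K i (im 1) (g + t) (g' + t).
  by apply: orb_shift => // m; apply: imK.
have ED x y : E x -> E y -> E (x + y).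
  move=> Ex /(Etr _ _ x); rewrite add0r addrC => Ey.
  exact: (orb_trans (im_group 1) im_stK Ex Ey).
have E0 : E 0 by apply: orb_refl.
have EMn x n : E x -> E (x *+ n).
  by move=> Ex; elim: n => [|n IHn]; rewrite ?mulr0n // mulrS; apply: ED.
have pathW m (s : Sg) (g : V) :
    reach (im 1) (K * m) (state_at s 0) g (state_at s (K * m)) (g + disp (K * m) s).
  apply: reach_end (reach_path A hh (K * m) s g (im_group 1)) => //.
  by have := imK m g; congr (im 1 _); zmod.
have [c cP] : exists c, forall j, live C j -> exists m (t : Sg), state_at t 0 = j /\
    state_at t (K * m) = i /\ forall a, (absz ((P *m disp (K * m) t) a 0%R) <= c)%N.
  apply: fin_all_bound => [j m n mn mP /mP [q [t [t0 [tq tP]]]]|j].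
    by exists q, t; split=> //; split=> // a; apply: leq_trans mn.
  have [lj|nlj] := classic (live C j); last by exists 0%N.
  have [q [t [_ [t0 tq]]]] := ftp_base_path Aunit ft K0 lj li.
  exists (\max_(a < k) absz ((P *m disp (K * q) t) a 0%R))%N => _.
  exists q, t; split=> //; split=> // a.
  exact: (leq_bigmax (F := fun a : 'I_k => absz ((P *m disp (K * q) t) a 0%R)) a).
move=> g g' o; have [u uE] : exists u, u = g' - g by exists (g' - g).
have Eu : E u by have := Etr _ _ (- g) o; rewrite subrr -uE.
have [v [Ev Puv]] : exists v, E v /\ P *m (u + v) = 0.
  apply: greedy_cancel => // e.
  have [s sP] : rot_set (iter N sh) (fun s => P *m (iter N (tau A hh) (s, 0)).2)
      (fun j => if e j then Rdiv eps 2 else Ropp (Rdiv eps 2)).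
    by apply: rotE => j; case: (e j); split_Rabs; lra.
  have [m1 [t1 [_ [t10 t1m]]]] := ftp_base_path Aunit ft K0 li (live_state s 0).
  pose b := (\max_(a < k) (absz ((P *m u) a 0%R) + absz ((P *m disp (K * m1) t1) a 0%R)))%N.
  have bP a : (absz ((P *m u) a 0%R) + absz ((P *m disp (K * m1) t1) a 0%R) <= b)%N.
    exact: (leq_bigmax (F := fun a : 'I_k =>
      absz ((P *m u) a 0%R) + absz ((P *m disp (K * m1) t1) a 0%R))%N a).
  have eps20 : Rlt 0 (Rdiv eps 2) by lra.
  (* [b] covers [u] and the path from [i] to the orbit, [c] the return path; a drift beyond b + c
     keeps its sign after closing up. *)
  have [n0 n0P] := rot_at_drift (b + c) eps20 sP.
  pose n := (k0 * n0)%N.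
  have [m2 [t2 [t20 [t2m t2c]]]] := cP _ (live_state s (K * n0)).
  exists (disp (K * m1) t1 + disp (K * n0) s + disp (K * m2) t2); split.
    exists (m1 + n0 + m2)%N; rewrite !mulnDr.
    apply: (@reach_comp S C d A hh (im 1) _ _ i 0 (state_at s (K * n0))
      (disp (K * m1) t1 + disp (K * n0) s) _ _ (im_group 1) (im_st _)).
      apply: (@reach_comp S C d A hh (im 1) _ _ i 0 (state_at s 0)
        (disp (K * m1) t1) _ _ (im_group 1) (im_st _)) => //.
        by have := pathW m1 t1 0; rewrite t10 t1m add0r.
    by have := pathW m2 t2 (disp (K * m1) t1 + disp (K * n0) s); rewrite t20 t2m.
  move=> j; have /(_ j n) := n0P; rewrite leq_pmull // => /(_ isT).
  have := @untwisted_sum k P N n s PA; rewrite /disp => ->; rewrite -/(disp _ _).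
  rewrite /n mulnA -/K !mulmxDr !addmx_entry; have := bP j; have := t2c j.
  move: ((P *m u) j 0) ((P *m disp (K * m1) t1) j 0) ((P *m disp (K * n0) s) j 0)
    ((P *m disp (K * m2) t2) j 0) => x1 x2 x3 x4.
  by case: (e j); lia.
(* As n (u + v) is trivial modulo im nil, -u is congruent to v + (n - 1)(u + v), a sum of reachable
   heights. *)
have [n [n0 nP]] : exists n : nat, (0 < n)%N /\ im 1 ((u + v) *+ n).
  apply: purification_multiple => //; move/Pker: Puv; rewrite /purification => pur G Gg Gp GX.
  apply: pur => // x [y ->]; apply: GX; exists y.
  by rewrite expr1 /nil mulmxBl mul1mx.
have Eu' : E (- u).
  have [m rm] : E (v + (u + v) *+ n.-1) by apply: (ED _ _ Ev (EMn _ _ (ED _ _ Eu Ev))).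
  exists m; apply: reach_end rm => //; rewrite opprK.
  by move: nP; rewrite -(prednK n0) mulrSr; congr (im 1 _); zmod.
have := Etr _ _ g' Eu'; rewrite add0r; congr (orb _ _ _ _ _).
by rewrite uE; zmod.
Qed.

(** Interpolates between im nil^(j+1), at q = 0, and im nil^j, at q = d, by adding the images of the
    first q basis vectors. *)
Let layer j q (x : V) := exists y u : V,
  x = nil ^+ j.+1 *m y + nil ^+ j *m u /\ forall l : 'I_d, (q <= l)%N -> u l 0 = 0.

(* Descends the flag im nil > im nil^2 > ... > 0, adding one generator
   nil^j e_q at a time; it equals A^N y - y for y = nil^(j-1) e_q. *)
Lemma unipotent_transitive k0 J : (0 < k0)%N -> nil ^+ J = 0 ->
  (forall g g', orb (N * k0) i (im 1) g g') ->
  forall g g', orb (N * k0) i (fun x => x = 0) g g'.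
Proof.
move=> k00 nilJ tr1; set K := (N * k0)%N.
have K0 : (0 < K)%N by rewrite muln_gt0 N0.
have comm j (x : V) : nil ^+ j *m (A ^+ N *m x) = A ^+ N *m (nil ^+ j *m x).
  by rewrite !imE mulmxDr !mulmxA mulmxE -exprSr -exprS.
have nilS j (x : V) : nil ^+ j.+1 *m x = nil *m (nil ^+ j *m x).
  by rewrite exprS -mulmxE mulmxA.
have layer_grp j q : is_subgroup (layer j q).
  split; first by exists 0, 0; rewrite !mulmx0 addr0; split=> // l _; rewrite mxE.
  move=> x x' [y [u [-> uq]]] [y' [u' [-> u'q]]]; exists (y - y'), (u - u'); split.
    by rewrite !mulmxBr; zmod.
  by move=> l ql; rewrite addmx_entry oppmx_entry uq // u'q // subr0.
have layer_st j q x : layer j q x -> layer j q (A ^+ N *m x).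
  move=> [y [u [-> uq]]]; exists (A ^+ N *m y + u), u; split=> //.
  rewrite mulmxDr -!comm [in RHS]mulmxDr; rewrite -addrA; congr (_ + _).
  by rewrite comm imE nilS addrC.
have layer_stK j q x : layer j q x -> layer j q (A ^+ K *m x).
  by rewrite /K exprM; apply: stableX => ?; apply: layer_st.
have step j q : (q < d)%N -> (forall g g', orb K i (layer j.+1 q.+1) g g') ->
    forall g g', orb K i (layer j.+1 q) g g'.
  move=> qd tr; pose l := Ordinal qd.
  apply: (symmetric_orb_transitive Aunit K0 li (layer_grp _ _)) => //.
    exact: layer_stK.
  apply: (@orb_extension_symmetric S C d A hh Aunit N k0 i (layer j.+1 q) (nil ^+ j *m delta_mx l 0)
    (nil ^+ j.+1 *m delta_mx l 0)) => //.
  - exact: layer_st.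
  - by rewrite imE nilS addrC addKr.
  - rewrite imE addrC addKr; exists (delta_mx l 0), 0; rewrite mulmx0 addr0 -nilS.
    by split=> // a _; rewrite mxE.
  - exact: (ftp_base_path Aunit ft K0 li li).
  move=> g g'; apply: orb_sub (tr g g') => x [y [u [-> uq]]].
  exists (u l 0), y, (u - u l 0 *: delta_mx l 0); split.
    by rewrite mulmxBr -scalemxAr; zmod.
  move=> a qa; rewrite addmx_entry oppmx_entry scalemx_entry mxE eqxx andbT.
  have [->|al] := eqVneq a l; first by rewrite mulr1 subrr.
  rewrite mulr0 subr0 uq // ltn_neqAle qa andbT.
  by apply: contra_neq al => qE; apply: val_inj.
have layers j : (forall g g', orb K i (im j.+1) g g') -> forall g g', orb K i (im j.+2) g g'.
  move=> tr.
  have : forall q, (q <= d)%N -> forall g g', orb K i (layer j.+1 (d - q)) g g'.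
    elim=> [|q IHq] qd.
      move=> g g'; apply: orb_sub (tr g g') => x [u ->]; exists 0, u.
      rewrite mulmx0 add0r subn0; split=> // l; rewrite leqNgt ltn_ord.
      by [].
    apply: step; first by lia.
    by have := IHq (ltnW qd); rewrite -[(d - q)%N]prednK ?subn_gt0 // -subnS.
  move/(_ d (leqnn d)); rewrite subnn => trd g g'.
  apply: orb_sub (trd g g') => x [y [u [-> u0]]]; exists y.
  have -> : u = 0 by apply/colP => l; rewrite u0 // mxE.
  by rewrite mulmx0 addr0.
have : forall j g g', orb K i (im j.+1) g g' by elim=> // j; apply: layers.
move=> /(_ J) trJ g g'; apply: orb_sub (trJ g g') => x [u ->].
by rewrite exprS nilJ mulr0 mul0mx.
Qed.

Lemma rot_transitive k0 J : (0 < k0)%N -> nil ^+ J = 0 ->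
  @zero_in_int_rotF S C d A hh N ->
  forall g g', orb (N * k0) i (fun x => x = 0) g g'.
Proof.
move=> k00 nilJ rot; apply: (unipotent_transitive k00 nilJ).
have K0 : (0 < N * k0)%N by rewrite muln_gt0 N0.
apply: (symmetric_orb_transitive Aunit K0 li (im_group 1)) => //.
  move=> x ix; rewrite -(subrK x (_ *m _)).
  exact: (subgroupD (im_group 1) (im1K _ _) ix).
exact: rot_symmetric.
Qed.

End Unipotent.
End Descent.

(** * Mixing and periodic points *)

Section Topology.
Import Order.TTheory GRing.Theory Num.Theory.
Local Open Scope ring_scope.
Variables (S : finType) (C : S -> S -> bool) (d : nat) (A : 'M[int]_d).
Variable hh : S -> S -> 'cV[int]_d.
Notation Sg := (Sig C).
Notation V := 'cV[int]_d.
Notation tauA := (@tau S C d A hh).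
Notation popen := (@prod_open S C d).
Notation disp := (@disp S C d A hh).
Notation reach := (@reach S C d A hh).
Notation orb := (@orb S C d A hh).
Notation sh := (@sshift S C).

Definition zero_sub (x : V) := x = 0.

Lemma zero_subgroup : is_subgroup zero_sub.
Proof. by split=> // x y -> ->; rewrite /zero_sub subrr. Qed.

Lemma zero_stable B (x : V) : zero_sub x -> zero_sub (B *m x).
Proof. by move=> ->; rewrite /zero_sub mulmx0. Qed.

Definition hgt (m : nat) (g : V) (s : Sg) : V := A ^+ m *m g + disp m s.

Lemma hgtD m n g s : hgt (m + n) g s = hgt n (hgt m g s) (iter m sh s).
Proof. by rewrite /hgt dispD addnC mulmxXD mulmxDr addrA. Qed.

Lemma eq_hgt m g s s' : (forall k, (k <= m)%N -> state_at s k = state_at s' k) ->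
  hgt m g s = hgt m g s'.
Proof. by move=> /(eq_disp A hh) e; rewrite /hgt e. Qed.

Lemma reach_hgt m (s : Sg) i g j g' : state_at s 0 = i -> state_at s m = j -> hgt m g s = g' ->
  reach zero_sub m i g j g'.
Proof. by move=> si sj sg; exists s; do !split=> //; rewrite /zero_sub -sg subrr. Qed.

Lemma zero_reach m i g j g' : reach zero_sub m i g j g' ->
  exists s : Sg, state_at s 0 = i /\ state_at s m = j /\ hgt m g s = g'.
Proof. by move=> [s [si [sj /eqP]]]; rewrite subr_eq0 => /eqP; exists s. Qed.

Definition all_reach := forall K i g j g', (0 < K)%N -> live C i -> live C j ->
  exists m, reach zero_sub (K * m) i g j g'.

(* The return times to (i, g) contain p and, by reachability along multiples
   of p, also some q = 1 mod p; hence they contain every large integer. *)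
Lemma all_reach_eventually : all_reach -> forall i g j g', live C i -> live C j ->
  exists n0, forall m, (n0 <= m)%N -> reach zero_sub m i g j g'.
Proof.
move=> ar i g j g' li lj; have [s s0] := li.
have rcomp m n i1 h1 i2 h2 i3 h3 : reach zero_sub m i1 h1 i2 h2 -> reach zero_sub n i2 h2 i3 h3 ->
    reach zero_sub (m + n) i1 h1 i3 h3.
  by apply: reach_comp; [apply: zero_subgroup|apply: zero_stable].
have r1 : reach zero_sub 1 i g (state_at s 1) (hgt 1 g s) by exact: (reach_hgt s0 erefl erefl).
have [m1 rm1] := ar 1%N _ (hgt 1 g s) _ g isT (live_state s 1) li.
have rp := rcomp _ _ _ _ _ _ _ _ r1 rm1; rewrite mul1n add1n in rp.
set p := m1.+1 in rp.
have [m2 rm2] := ar p _ (hgt 1 g s) _ g isT (live_state s 1) li.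
have rq := rcomp _ _ _ _ _ _ _ _ r1 rm2.
have [m0 rm0] := ar 1%N _ g _ g' isT li lj; rewrite mul1n in rm0.
have rmul l a : reach zero_sub l i g i g -> reach zero_sub (l * a) i g i g.
  move=> rl; elim: a => [|a IHa]; first by rewrite muln0; apply: reach0 => //; apply: zero_subgroup.
  by rewrite mulnS; apply: rcomp rl IHa.
(* With q = 1 + p [m2], b copies of q supply the residue of m - m0 modulo p. The threshold keeps the
   remaining multiple of p nonnegative. *)
exists (m0 + p * (1 + p * m2))%N => m mm.
pose r := (m - m0)%N; pose b := (r %% p)%N.
have bp : (b <= p)%N by apply: ltnW; rewrite ltn_pmod.
have mE : m = (p * (r %/ p - m2 * b) + (1 + p * m2) * b + m0)%N.
  have rE := divn_eq r p.
  have : (m2 * b <= r %/ p)%N.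
    have le1 : (m2 * b * p <= m2 * p * p)%N by apply: leq_mul (leq_mul _ bp) _.
    have e1 : (p * (1 + p * m2) = p + m2 * p * p)%N by ring.
    by rewrite leq_divRL // /r; lia.
  have mr : m = (r + m0)%N by rewrite /r; lia.
  rewrite [LHS]mr [in LHS]rE -/b => /subnK e; rewrite -{1}e.
  by move: (_ - _)%N => a; ring.
by rewrite mE; apply: (rcomp _ _ _ _ _ _ _ _
  (rcomp _ _ _ _ _ _ _ _ (rmul _ _ rp) (rmul _ _ rq)) rm0).
Qed.

Hypothesis Aunit : A \in unitmx.

Lemma connect (n : nat) (s : Sg) g (s' : Sg) g' : exists i g1 j g2, live C i /\ live C j /\
  forall p, reach zero_sub p i g1 j g2 ->
  exists t : Sg, (forall z, (z <= Z.of_nat n)%ZZ -> sval t z = sval s z) /\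
    (forall z, (- Z.of_nat n <= z)%ZZ -> sval t (Z.of_nat (n + p + n) + z)%ZZ = sval s' z) /\
    hgt (n + p + n) g t = g'.
Proof.
pose s2 := shiftZ (- Z.of_nat n) s'.
have [g2 g2E] := mulmxX_surj Aunit n (g' - disp n s2).
exists (state_at s n), (hgt n g s), (state_at s2 0), g2; 
split; first exact: live_state.
split; first exact: live_state.
move=> p /zero_reach[w [w0 [wp wg]]].
have [|t1 [t1l t1r]] := @glue S C s w n; first by rewrite w0.
have t1E k : state_at t1 (n + k) = state_at w k.
  by rewrite /state_at -t1r; [congr (sval t1); lia|lia].
have [|t [tl tr]] := @glue S C t1 s2 (n + p); first by rewrite t1E wp.
exists t; split; first by move=> z zn; rewrite tl ?t1l //; lia.
split=> [z zn|].
  rewrite (_ : (Z.of_nat (n + p + n) + z = Z.of_nat (n + p) + (Z.of_nat n + z))%ZZ); last lia.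
  by rewrite tr ?sval_shiftZ; [congr (sval s'); lia|lia].
rewrite !hgtD.
have -> : hgt n g t = hgt n g s.
  by apply: eq_hgt => k kn; rewrite /state_at tl ?t1l //; lia.
have -> : hgt p (hgt n g s) (iter n sh t) = hgt p (hgt n g s) w.
  apply: eq_hgt => k kp; rewrite state_iter_shift -t1E /state_at tl //; lia.
rewrite wg; have -> : hgt n g2 (iter (n + p) sh t) = hgt n g2 s2.
  apply: eq_hgt => k kn; rewrite state_iter_shift /state_at.
  by rewrite -tr; [congr (sval t); lia|lia].
by rewrite /hgt g2E subrK.
Qed.

Lemma totally_transitive_ftp : totally_transitive popen tauA -> @total_ftp S C d A hh.
Proof. by move=> tt k k0 G _ _ _ U V oU oV _ _; apply: tt. Qed.

Lemma totally_transitive_reach : totally_transitive popen tauA -> all_reach.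
Proof.
move=> tt K i g j g' K0 li lj.
apply: (transitive_reach Aunit zero_subgroup) => //.
- exact: zero_stable.
- by move=> k k0 U V oU oV _ _; apply: tt.
Qed.

Lemma eventually_mixing : (forall i g j g', live C i -> live C j ->
    exists n0, forall m, (n0 <= m)%N -> reach zero_sub m i g j g') ->
  top_mixing popen tauA.
Proof.
move=> ev U V oU oV [[s g] Us] [[s' g'] Vs'].
have [n1 n1P] := oU _ Us; have [n2 n2P] := oV _ Vs'; pose n := maxn n1 n2.
have [i [g1 [j [g2 [li [lj con]]]]]] := connect n s g s' g'.
have [n0 n0P] := ev i g1 j g2 li lj.
exists (n0 + n + n)%N => m mn.
have [|t [tl [tr tg]]] := con (m - n - n)%N; first by apply: n0P; lia.
have mE : (n + (m - n - n) + n = m)%N by lia.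
rewrite mE in tr tg; exists (t, g); split.
  by apply: n1P => //= z zn; apply: tl; rewrite /n; lia.
rewrite iter_tau -/(hgt m g t) tg; apply: n2P => //= z zn.
rewrite sval_iter_shift -tr; [congr (sval t); lia|rewrite /n; lia].
Qed.

Lemma mixing_totally_transitive : top_mixing popen tauA -> totally_transitive popen tauA.
Proof.
move=> mix k k0 U V oU oV nU nV; have [n0 n0P] := mix U V oU oV nU nV.
have [x [Ux Vx]] := n0P _ (leq_pmulr n0 k0).
by exists n0; left; exists x; rewrite -iterM.
Qed.

Lemma all_reach_periodic : all_reach -> periodic_dense popen tauA.
Proof.
(* The window is enlarged by one so that the period is positive even if the connecting path is
   empty. *)
move=> ar U oU [[s g] Us]; have [n0 n0P] := oU _ Us; pose n := n0.+1.
have [i [g1 [j [g2 [li [lj con]]]]]] := connect n s g s g.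
have [p rp] := ar 1%N i g1 j g2 isT li lj.
have [t [tl [tr tg]]] := con _ rp.
set L := (n + 1 * p + n)%N in tr tg; have L0 : (0 < L)%N by rewrite /L /n; lia.
have tL k : (k <= n)%N -> sval t (Z.of_nat L - Z.of_nat k)%ZZ = sval s (- Z.of_nat k)%ZZ.
  by move=> kn; rewrite -tr; [congr (sval t); lia|lia].
have [||w wP] := @concat_blocks S C L (state_at s 0) (fun=> t) L0.
- by move=> _; rewrite /state_at tl //; lia.
- by move=> _; rewrite /state_at -[Z.of_nat L]Z.sub_0_r (tL 0%N).
have w0 r : (r <= L)%N -> state_at w r = state_at t r.
  by move=> rL; rewrite -(wP 0%ZZ).
exists (w, g); split.
  apply: n0P => //= z zn; case: (Z.neg_nonneg_cases z) => z0; last first.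
    have -> : z = Z.of_nat (Z.to_nat z) by lia.
    rewrite -/(state_at w _) w0 /state_at ?tl //; rewrite /L /n; lia.
  (* Negative coordinates are read off the end of the preceding block, where [tL] matches [s]. *)
  have := wP (-1)%ZZ (L - Z.to_nat (- z))%N; rewrite leq_subr => /(_ isT).
  rewrite (_ : (-1 * Z.of_nat L + Z.of_nat (L - Z.to_nat (- z)) = z)%ZZ); last first.
    by rewrite /L /n; lia.
  move=> ->; rewrite /state_at (_ : Z.of_nat (L - _) = Z.of_nat L - Z.of_nat (Z.to_nat (- z)))%ZZ.
    by rewrite tL; [congr (sval s); lia|rewrite /n; lia].
  by rewrite /L /n; lia.
exists L; split=> //; rewrite iter_tau -/(hgt L g w) (@eq_hgt L g w t) // tg; congr (_, _).
apply: sig_ext => z; rewrite sval_iter_shift.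
pose l := Z.of_nat L; pose q := (z / l)%ZZ; pose r := Z.to_nat (z mod l)%ZZ.
have l0 : (0 < l)%ZZ by rewrite /l; lia.
have zr : z = (q * l + Z.of_nat r)%ZZ.
  by rewrite /r Z2Nat.id /q; have := Z.div_mod z l; have := Z.mod_pos_bound z l; lia.
have rL : (r <= L)%N by rewrite /r; have := Z.mod_pos_bound z l l0; rewrite /l; lia.
rewrite {2}zr wP // -(wP (q + 1)%ZZ) //; congr (sval w).
by rewrite {1}zr /l; lia.
Qed.

(** A periodic point in the cylinder of a path from g to g' returns to g along the rest of its
    orbit. Running the period [L] times makes the remaining length a multiple of [K]. *)
Lemma periodic_symmetric : periodic_dense popen tauA -> forall K i g g',
  orb K i zero_sub g g' -> orb K i zero_sub g' g.
Proof.
move=> pd K i g g' [m rm]; have := zero_reach rm => -[s [s0 [sm sg]]].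
have [Km0|Km0] := posnP (K * m).
  have -> : g' = g by rewrite -sg Km0 /hgt mulmxX0 disp0 addr0.
  by exists 0%N; rewrite muln0; apply: reach0; [apply: zero_subgroup|exists s].
set L := (K * m)%N in sm sg Km0 *.
have [||[t h] [[/= tc hg] [n [n0 per]]]] := pd (cyl zero_sub s g L).
- exact: cyl_open.
- by exists (s, g); apply: cyl_self; apply: zero_subgroup.
have {hg} hg : h = g by apply/eqP; rewrite -subr_eq0; apply/eqP.
subst h.
have perk k : iter (n * k) tauA (t, g) = (t, g).
  by elim: k => [|k IHk]; rewrite ?muln0 // mulnS iterD IHk.
have := perk L; case: n n0 {per perk} => // n _; rewrite iter_tau -/(hgt _ g t) => -[shE hE].
exists (m * n)%N; have LE : (n.+1 * L = L + K * (m * n))%N by rewrite /L; lia.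
rewrite LE in shE hE; apply: (reach_hgt (s := iter L sh t)).
- by rewrite state_iter_shift addn0 tc.
- by rewrite state_iter_shift -[(L + _)%N]addn0 -state_iter_shift shE tc.
- by rewrite -sg -(@eq_hgt L g t s) // -hgtD.
Qed.

(** Any base path leads to the target state; transitivity of heights there corrects the error. *)
Lemma orb_all_reach N : (0 < N)%N -> @total_ftp S C d A hh ->
  (forall i k, live C i -> (0 < k)%N -> forall g g', orb (N * k) i zero_sub g g') -> all_reach.
Proof.
move=> N0 ft tr K i g j g' K0 li lj.
have NK0 : (0 < N * K)%N by rewrite muln_gt0 N0.
have [m1 [s [_ [s0 sm]]]] := ftp_base_path Aunit ft NK0 li lj.
have [m2 rm2] := tr j K lj K0 (hgt (N * K * m1) g s) g'.
exists (N * (m1 + m2))%N; rewrite mulnCA mulnA mulnDr.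
apply: (@reach_comp S C d A hh zero_sub _ _ i g j (hgt (N * K * m1) g s)) => //.
- exact: zero_subgroup.
- exact: zero_stable.
- exact: reach_hgt s0 sm erefl.
Qed.

End Topology.

(** * Eigenvalues of integer matrices *)

Section Spectrum.
Import Order.TTheory GRing.Theory Num.Theory.
Local Open Scope ring_scope.
Variable (n' : nat).
Notation n := n'.+1.
Implicit Types (A : 'M[int]_n) (B : 'M[algC]_n).

Lemma cpolyE A : cpoly A = char_poly (map_mx intr A). Proof. by []. Qed.

Lemma map_mxX A m : map_mx intr (A ^+ m) = (map_mx intr A : 'M[algC]_n) ^+ m.
Proof.
elim: m => [|m IHm]; first by rewrite !expr0 map_mx1.
by rewrite !exprS -!mulmxE map_mxM IHm.
Qed.

Lemma eigenvalue_det B a : eigenvalue B a = (\det (B - a%:M) == 0).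
Proof. by rewrite /eigenvalue /eigenspace kermx_eq0 row_free_unit unitmxE unitfE negbK. Qed.

Lemma cpoly_root A a : root (cpoly A) a = eigenvalue (map_mx intr A) a.
Proof. by rewrite cpolyE eigenvalue_root_char. Qed.

Lemma cpoly_rootX A a m : root (cpoly A) a -> root (cpoly (A ^+ m)) (a ^+ m).
Proof.
rewrite !cpoly_root map_mxX => /eigenvalueP[v vA v0]; apply/eigenvalueP; exists v => //.
elim: m => [|m IHm]; first by rewrite !expr0 mulmx1 scale1r.
by rewrite exprS -mulmxE mulmxA vA -scalemxAl IHm scalerA -exprS.
Qed.

(** Split X^m - b into linear factors: if B^m - b is singular, so is B - a for some root a. *)
Lemma cpoly_rootX_inv A b m : (0 < m)%N -> root (cpoly (A ^+ m)) b ->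
  exists a, root (cpoly A) a /\ b = a ^+ m.
Proof.
move=> m0; rewrite cpoly_root map_mxX eigenvalue_det; set B := map_mx _ _.
pose p : {poly algC} := 'X^m - b%:P.
have [r pE] := closed_field_poly_normal p.
have pB : horner_mx B p = B ^+ m - b%:M.
  by rewrite /p rmorphB rmorphXn /= horner_mx_X horner_mx_C.
have p1 : lead_coef p = 1 by apply/eqP; apply: monicXnsubC.
rewrite -pB pE p1 scale1r rmorph_prod /=.
have -> : \det (\prod_(z <- r) horner_mx B ('X - z%:P)) = \prod_(z <- r) \det (B - z%:M).
  elim: r {pE} => [|z r IHr]; first by rewrite !big_nil det1.
  by rewrite !big_cons -mulmxE det_mulmx IHr rmorphB /= horner_mx_X horner_mx_C.
rewrite prodf_seq_eq0 => /hasP[a ar /= aB]; exists a.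
rewrite cpoly_root eigenvalue_det; split=> //.
have : root p a by rewrite pE p1 scale1r root_prod_XsubC.
by rewrite /root /p !hornerE subr_eq0 => /eqP.
Qed.

Lemma cpoly_has_root A : exists a, root (cpoly A) a.
Proof. by apply/closed_rootP; rewrite cpolyE size_char_poly. Qed.

(** Multiplication by X - z with z in the unit disc at most doubles a coefficient bound. *)
Lemma coef_prod_bound (r : seq algC) i : (forall z, z \in r -> `|z| <= 1) ->
  `|(\prod_(z <- r) ('X - z%:P))`_i| <= (2 ^ size r)%:R.
Proof.
elim: r i => [|z r IHr] i rP.
  by rewrite big_nil coef1; case: (i == 0)%N; rewrite ?normr1 ?normr0.
rewrite big_cons mulrBl coefB coefXM coefCM /= expnS mul2n -addnn natrD.
apply: le_trans (ler_normB _ _) _; apply: lerD.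
  case: (i == 0)%N; first by rewrite normr0 ler0n.
  by apply: IHr => w wr; apply: rP; rewrite inE wr orbT.
rewrite normrM; apply: le_trans (_ : 1 * `|(\prod_(z <- r) ('X - z%:P))`_i| <= _).
  by apply: ler_wpM2r => //; apply: rP; rewrite inE eqxx.
by rewrite mul1r; apply: IHr => w wr; apply: rP; rewrite inE wr orbT.
Qed.

Lemma cpoly_split A : exists r : seq algC, size r = n /\
  cpoly A = \prod_(z <- r) ('X - z%:P).
Proof.
have [r] := closed_field_poly_normal (cpoly A).
have /eqP -> : lead_coef (cpoly A) == 1 by rewrite cpolyE; apply: char_poly_monic.
rewrite scale1r => pE; exists r; split=> //.
by have := size_prod_XsubC r id; rewrite -pE cpolyE size_char_poly => -[].
Qed.

(* Kronecker's theorem: the characteristic polynomials of the powers of A have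
   bounded integer coefficients, so two powers of an eigenvalue coincide. *)
Lemma eigenvalue_root_of_unity A l : (forall a, root (cpoly A) a -> `|a| <= 1) ->
  A \in unitmx -> root (cpoly A) l -> exists m, (0 < m)%N /\ l ^+ m = 1.
Proof.
move=> A1 Au rl.
have l0 : l != 0.
  apply: contraTneq rl => ->; rewrite cpoly_root eigenvalue_det raddf0 subr0 det_map_mx.
  by rewrite intr_eq0; apply: contraTneq Au => D0; rewrite unitmxE D0 unitr0.
have bnd m i : (absz ((char_poly (A ^+ m))`_i)%R <= 2 ^ n)%N.
  have [r [rn rE]] := cpoly_split (A ^+ m).
  have := @coef_prod_bound r i; rewrite -rE rn => /(_ _) h.
  have {}h : `|(cpoly (A ^+ m))`_i| <= (2 ^ n)%:R.
    apply: h => z zr; have : root (cpoly (A ^+ m)) z by rewrite rE root_prod_XsubC.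
    have [->|m0] := posnP m; last first.
      by case/(cpoly_rootX_inv m0) => a [ra ->]; rewrite normrX exprn_ile1 ?A1.
    rewrite expr0 cpoly_root map_mx1 => /eigenvalueP[v]; rewrite mulmx1 => vz v0.
    have : (z - 1) *: v == 0 by rewrite scalerBl scale1r -vz subrr.
    by rewrite scaler_eq0 (negbTE v0) orbF subr_eq0 => /eqP ->; rewrite normr1.
  move: h; rewrite cpolyE -map_char_poly coef_map /= -intr_norm.
  by rewrite -[(2 ^ n)%:R]/((2 ^ n)%:Z%:~R) ler_int -abszE lez_nat.
pose rts (p : {poly algC}) := sval (closed_field_poly_normal p).
(* Records the coefficients, shifted by 2^n to be nonnegative, and the position of l^m in the list
   of roots. *)
pose code m : {ffun 'I_n.+1 -> 'I_(2 * 2 ^ n).+1} * 'I_n.+1 :=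
  ([ffun i => inord (absz ((char_poly (A ^+ m))`_(i : 'I_n.+1) + (2 ^ n)%:Z))],
   inord (index (l ^+ m) (rts (cpoly (A ^+ m))))).
have rtsP m : size (rts (cpoly (A ^+ m))) = n /\ l ^+ m \in rts (cpoly (A ^+ m)).
  rewrite /rts; case: closed_field_poly_normal => r /= pE.
  have l1 : lead_coef (cpoly (A ^+ m)) = 1.
    by apply/eqP; rewrite cpolyE; apply: char_poly_monic.
  move: pE; rewrite l1 scale1r => pE; split.
    by have := size_prod_XsubC r id; rewrite -pE cpolyE size_char_poly => -[].
  by have := cpoly_rootX m rl; rewrite pE root_prod_XsubC.
have [a [b [ab [cab iab]]]] := pigeonhole code.
have pab : cpoly (A ^+ a) = cpoly (A ^+ b).
  rewrite !cpolyE -!map_char_poly; congr (map_poly _ _); apply/polyP => i.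
  have [ni|ni] := ltnP i n.+1; last by rewrite !nth_default // size_char_poly.
  have /ffunP/(_ (Ordinal ni)) := cab; rewrite !ffunE => /(congr1 val) /=.
  have := bnd a i; have := bnd b i.
  move: (char_poly (A ^+ a))`_i (char_poly (A ^+ b))`_i => x y ? ?.
  by rewrite !inordK; lia.
have iE : index (l ^+ a) (rts (cpoly (A ^+ a))) = index (l ^+ b) (rts (cpoly (A ^+ b))).
  move/(congr1 val): iab; have [sa _] := rtsP a; have [sb _] := rtsP b.
  have := index_size (l ^+ a) (rts (cpoly (A ^+ a))); rewrite sa => la.
  have := index_size (l ^+ b) (rts (cpoly (A ^+ b))); rewrite sb => lb.
  by rewrite /= !inordK.
have lab : l ^+ a = l ^+ b.
  have [_ ina] := rtsP a; have [_ inb] := rtsP b.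
  by rewrite -(nth_index 0 ina) -(nth_index 0 inb) iE pab.
exists (b - a)%N; split; first by rewrite subn_gt0.
apply: (mulfI (expf_neq0 a l0)); rewrite -exprD subnKC 1?ltnW // mulr1.
exact: esym.
Qed.

(** A common multiple of the orders of the eigenvalues trivializes the spectrum; descent finds the
    least such exponent. *)
Lemma ex_NA A : (forall a, root (cpoly A) a -> `|a| <= 1) -> A \in unitmx ->
  exists N, is_NA A N.
Proof.
move=> A1 Au.
have [N [N0 NP]] : exists N, (0 < N)%N /\ spec_is_one (A ^+ N).
  have [r [rn rE]] := cpoly_split A.
  have rr z : z \in r -> root (cpoly A) z by rewrite rE root_prod_XsubC.
  have [N [N0 NP]] : exists N, (0 < N)%N /\ forall z, z \in r -> z ^+ N = 1.
    elim: r rr {rn rE} => [|z r IHr] rr; first by exists 1%N.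
    have [|N [N0 NP]] := IHr; first by move=> w wr; apply: rr; rewrite inE wr orbT.
    have [|m [m0 mP]] := @eigenvalue_root_of_unity A z A1 Au; first by apply: rr; rewrite inE eqxx.
    exists (m * N)%N; rewrite muln_gt0 m0 N0; split=> // w; rewrite inE => /orP[/eqP->|wr].
      by rewrite exprM mP expr1n.
    by rewrite mulnC exprM NP // expr1n.
  exists N; split=> //; split; last exact: cpoly_has_root.
  move=> l /(cpoly_rootX_inv N0)[a [ra ->]]; apply: NP.
  by rewrite -root_prod_XsubC -rE.
elim/ltn_ind: N N0 NP => N IHN N0 NP.
have [[M [M0 [MN MP]]]|nex] := classic (exists M, (0 < M)%N /\ (M < N)%N /\ spec_is_one (A ^+ M)).
  exact: (IHN M).
by exists N; split=> //; split=> // M M0 MN MP; apply: nex; exists M.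
Qed.

Lemma spectral_radius_one A : (forall a, root (cpoly A) a -> `|a| <= 1) ->
  A \in unitmx -> spec_radius_one A.
Proof.
move=> A1 Au; split=> //; have [l rl] := cpoly_has_root A; exists l; split=> //.
have [m [m0 lm]] := eigenvalue_root_of_unity A1 Au rl.
by apply/eqP; rewrite -(pexpr_eq1 m0) // -normrX lm normr1.
Qed.

(** The characteristic polynomial is (X - 1)^n, so Cayley-Hamilton applies over [algC] and descends
    to the integers. *)
Lemma spec_one_nilpotent A : spec_is_one A -> exists J, (A - 1) ^+ J = 0.
Proof.
move=> [A1 _]; have [r [rn rE]] := cpoly_split A; exists n.
have rX : cpoly A = ('X - 1%:P) ^+ n.
  have -> : cpoly A = \prod_(z <- r) ('X - 1%:P).
    rewrite rE; apply: eq_big_seq => z zr; rewrite (A1 z) //.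
    by rewrite rE root_prod_XsubC.
  by rewrite big_const_seq count_predT rn iter_mulr_1.
have := Cayley_Hamilton (map_mx intr A : 'M[algC]_n); rewrite -cpolyE rX rmorphXn rmorphB /=.
rewrite horner_mx_X horner_mx_C -(map_mx1 intr) -map_mxB -map_mxX => /matrixP AJ.
by apply/matrixP => i j; have := AJ i j; rewrite !mxE => /eqP; rewrite intr_eq0 => /eqP.
Qed.

(** Ensures that the Fried quotient has positive rank. *)
Lemma spec_one_det A : spec_is_one A -> \det (A - 1) = 0.
Proof.
move=> [A1 [l rl]]; have l1 := A1 l rl; move: rl; rewrite l1 cpoly_root eigenvalue_det.
by rewrite -(map_mx1 intr) -map_mxB det_map_mx intr_eq0 => /eqP.
Qed.

End Spectrum.

(** * The Fried quotient and its rotation set *)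

Section Fried.
Import Order.TTheory GRing.Theory Num.Theory.
Local Open Scope ring_scope.
Variable (d : nat).

(* Read off from the Smith normal form L D R of B - 1: the rows of L^-1 at the
   zeros of D are coordinates on the quotient. *)
Lemma fried_quotient (B : 'M[int]_d) : \det (B - 1) = 0 ->
  exists (k : nat) (P : 'M[int]_(k, d)), (0 < k)%N /\
    (forall y : 'cV[int]_k, exists x, P *m x = y) /\
    (forall x, P *m x = 0 <-> purification (im_minus_id B) x).
Proof.
move=> det0; have [L Lu [R Ru [s _ BE]]] := int_Smith_normal_form (B - 1).
pose D : 'M[int]_d := \matrix_(i, j) (s`_i *+ (i == j :> nat)).
rewrite -/D in BE.
have DE (x : 'cV[int]_d) j : (D *m x) j 0 = s`_j * x j 0.
  rewrite mxE (bigD1 j) //= mxE eqxx mulr1n big1 ?addr0 // => l lj.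
  by rewrite mxE (_ : (j == l :> nat) = false) ?mulr0n ?mul0r //; apply/negbTE; rewrite eq_sym.
pose I := [pred j : 'I_d | s`_j == 0].
pose P : 'M[int]_(#|I|, d) := \matrix_(a, j) invmx L (enum_val a) j.
have PE (x : 'cV[int]_d) a : (P *m x) a 0 = (invmx L *m x) (enum_val a) 0.
  by rewrite !mxE; apply: eq_bigr => j _; rewrite mxE.
exists #|I|, P; split.
  have : \prod_(j < d) s`_j == 0.
    have DD : D = diag_mx (\row_j s`_j).
      by apply/matrixP => a b; rewrite !mxE -val_eqE.
    have := det0; rewrite BE !det_mulmx DD det_diag => /eqP.
    rewrite !mulf_eq0; have nz (U : 'M[int]_d) : U \in unitmx -> (\det U == 0) = false.
      by rewrite unitmxE => Uu; apply/negbTE; apply: contraTneq Uu => ->; rewrite unitr0.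
    rewrite !nz // orbF /= => /eqP e; apply/eqP; rewrite -[RHS]e.
    by apply: eq_bigr => j _; rewrite mxE.
  by rewrite prodf_seq_eq0 => /hasP[j _ /= sj]; apply/card_gt0P; exists j.
split=> [y|x].
  exists (L *m \sum_a y a 0 *: delta_mx (enum_val a) 0); apply/colP => a.
  rewrite PE mulKmx // summxE (bigD1 a) //= !mxE !eqxx mulr1 big1 ?addr0 // => b ba.
  by rewrite !mxE (inj_eq enum_val_inj) eq_sym (negbTE ba) mulr0.
split=> [Px|pur].
  have [w wE] : exists w, w = invmx L *m x by exists (invmx L *m x).
  have w0 (j : 'I_d) : s`_j == 0 -> w j 0 = 0.
    move=> sj; have jI : j \in I by [].
    have := congr1 (fun z : 'cV__ => z (enum_rank_in jI j) 0) Px.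
    by rewrite /= PE enum_rankK_in // -wE zeromx_entry.
  (* Clears denominators: c x lies in im(B - 1), and purity then yields x. *)
  pose c := \prod_(j < d | s`_j != 0) s`_j.
  have c0 : c != 0 by apply/prodf_neq0.
  have cw : c *: w = D *m (\col_j ((\prod_(l < d | (s`_l != 0) && (l != j)) s`_l) * w j 0)).
    apply/colP => j; rewrite DE !mxE mulrA; have [sj|sj] := eqVneq s`_j 0.
      by rewrite w0 ?sj // !mulr0.
    by rewrite /c (bigD1 j).
  move=> G Gg Gp GX; apply: (Gp x c c0); apply: GX.
  exists (invmx R *m (\col_j ((\prod_(l < d | (s`_l != 0) && (l != j)) s`_l) * w j 0))).
  have e u : B *m u - u = (B - 1) *m u by rewrite mulmxBl mul1mx.
  by rewrite e BE -mulmxA mulKVmx // -mulmxA -cw -scalemxAr wE mulKVmx.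
apply: (pur (fun x => P *m x = 0)).
- by split; [rewrite mulmx0|move=> a b ea eb; rewrite mulmxBr ea eb subrr].
- move=> g m m0 /colP e; apply/colP => a; have /eqP := e a.
  by rewrite -scalemxAr scalemx_entry zeromx_entry mulf_eq0 (negbTE m0) => /eqP.
move=> z [u ->]; apply/colP => a.
have -> : B *m u - u = (B - 1) *m u by rewrite mulmxBl mul1mx.
rewrite PE BE -!mulmxA mulKmx // DE zeromx_entry.
by have := enum_valP a; rewrite inE => /eqP ->; rewrite mul0r.
Qed.

End Fried.

Section IntReal.
Import Order.TTheory GRing.Theory Num.Theory.
Local Open Scope ring_scope.

Lemma int2R_IZR z : int2R z = IZR (Z_of_int z).
Proof.
case: z => n /=; first by rewrite INR_IZR_INZ.
by change (Ropp (INR n.+1) = IZR (Z_of_int (Negz n))); rewrite INR_IZR_INZ -opp_IZR; congr IZR; lia.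
Qed.

Lemma int2RD x y : int2R (x + y) = Rplus (int2R x) (int2R y).
Proof. by rewrite !int2R_IZR -plus_IZR; congr IZR; lia. Qed.

Lemma int2R_lt x y : Rlt (int2R x) (int2R y) -> x < y.
Proof. by rewrite !int2R_IZR => /lt_IZR; lia. Qed.

Lemma int2R_abs x K : (absz x <= K)%N -> Rle (Rabs (int2R x)) (INR K).
Proof.
by move=> xK; rewrite int2R_IZR -abs_IZR INR_IZR_INZ; apply: IZR_le; lia.
Qed.

Definition floorR (r : R) : int := int_of_Z (Int_part r).

Lemma floorRP r : Rle (int2R (floorR r)) r /\ Rlt r (int2R (floorR r) + 1).
Proof.
rewrite int2R_IZR /floorR int_of_ZK; have := base_Int_part r; lra.
Qed.

Lemma floorR0 : floorR 0 = 0.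
Proof.
have [] := floorRP 0; move: (floorR 0) => z h1 h2.
have z1 : z < 1 by apply: int2R_lt => /=; lra.
have z2 : -1 < z by apply: int2R_lt => /=; lra.
lia.
Qed.

(** Increments -1, 0, 1 are coded by ['I_3] so that increment vectors form a finite type. *)
Lemma floorR_step r u : Rlt (Rabs u) 1 ->
  exists c : 'I_3, floorR (Rplus r u) = floorR r + ((c : nat)%:Z - 1).
Proof.
move=> u1; have [] := floorRP r; have [] := floorRP (Rplus r u).
move: (floorR r) (floorR _) => x y h1 h2 h3 h4.
have xy : x - 2 < y.
  apply: int2R_lt; rewrite int2RD (_ : int2R (-2) = Ropp (IZR (Zpos 2))) /=;
    last by rewrite /=; lra.
  by move: u1; split_Rabs; lra.
have yx : y < x + 2.
  apply: int2R_lt; rewrite int2RD (_ : int2R 2 = IZR (Zpos 2)) /=; last by rewrite /=; lra.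
  by move: u1; split_Rabs; lra.
exists (inord (absz (y - x + 1))); rewrite inordK; lia.
Qed.

End IntReal.

(** * Necessity of the spectral and rotation conditions *)

Section Necessity.
Import Order.TTheory GRing.Theory Num.Theory.
Local Open Scope ring_scope.
Variables (S : finType) (C : S -> S -> bool) (d : nat) (A : 'M[int]_d).
Variable hh : S -> S -> 'cV[int]_d.
Notation Sg := (Sig C).
Notation V := 'cV[int]_d.
Notation disp := (@disp S C d A hh).
Notation hgt := (@hgt S C d A hh).
Notation sh := (@sshift S C).
Hypothesis ar : @all_reach S C d A hh.

(* A left eigenvector for |l| > 1 gives a functional whose modulus grows along
   orbits once it is large, so the zero height cannot be reached again. *)
Lemma all_reach_spectrum i l : live C i -> root (cpoly A) l -> `|l| <= 1.
Proof.
move=> li; rewrite -eigenvalue_root_char => /eigenvalueP[v vA v0].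
rewrite real_leNgt ?normr_real ?real1 //; apply/negP => l1.
pose f (g : V) : algC := (v *m map_mx intr g) 0 0.
have fD g h : f (g + h) = f g + f h by rewrite /f map_mxD mulmxDr mxE.
have fA g : f (A *m g) = l * f g.
  by rewrite /f map_mxM mulmxA (_ : v *m _ = l *: v) // -scalemxAl mxE.
pose H := \sum_(p : S * S) `|f (hh p.1 p.2)|.
have Hle a b : `|f (hh a b)| <= H.
  by rewrite /H (bigD1 (a, b)) //= lerDl sumr_ge0.
have H0 : 0 <= H by apply: sumr_ge0.
have [j vj] : exists j, v 0 j != 0.
  apply: NNPP => nex; move/eqP: v0; apply; apply/rowP => j; rewrite [RHS]mxE.
  by apply/eqP; apply: NNPP => nj; apply: nex; exists j; apply/negP.
have l10 : 0 < `|l| - 1 by rewrite subr_gt0.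
have vj0 : 0 < `|v 0 j| by rewrite normr_gt0.
pose x := (H + 1) / (`|l| - 1) / `|v 0 j|.
have x0 : 0 <= x by exact: divr_ge0 (divr_ge0 (addr_ge0 H0 ler01) (ltW l10)) (ltW vj0).
pose m := Num.bound x; have mx := archi_boundP x0.
pose g : V := m%:Z *: delta_mx j 0.
have fg : f g = m%:R * v 0 j.
  rewrite /f mxE (bigD1 j) //= big1 ?addr0 => [|b bj].
    by rewrite !mxE !eqxx mulr1 mulrC.
  by rewrite !mxE (negbTE bj) mulr0 rmorph0 mulr0.
have big : H + 1 <= `|f g| * (`|l| - 1).
  rewrite -ler_pdivrMr // fg normrM normr_nat -ler_pdivrMr //.
  exact: ltW mx.
(* If |f w| (|l| - 1) >= H, the next value is at least |l| |f w| - H >= |f w|, so the bound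
   persists; at height 0 it would say H + 1 <= 0. *)
have grow (s : Sg) k : H + 1 <= `|f (hgt k g s)| * (`|l| - 1).
  elim: k => [|k IHk]; first by rewrite /hgt mulmxX0 disp0 addr0.
  have -> : hgt k.+1 g s = A *m hgt k g s + hh (state_at s k) (state_at s k.+1).
    by rewrite /hgt dispS mulmxXS mulmxDr addrA.
  move: (hgt k g s) IHk => w IHk.
  apply: (le_trans IHk); apply: ler_wpM2r; first exact: ltW.
  rewrite fD fA; move: (Hle (state_at s k) (state_at s k.+1)) => h1.
  have h2 := lerB_normD (l * f w) (f (hh (state_at s k) (state_at s k.+1))).
  apply: le_trans h2; rewrite normrM lerBrDr; move: IHk h1.
  set y := `|f _|; set z := `|f (hh _ _)| => IHk h1.
  apply: (@le_trans _ _ (y + y * (`|l| - 1))); last by rewrite mulrBr mulr1 addrC subrK mulrC.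
  rewrite lerD2l; apply: le_trans h1 (le_trans _ IHk).
  by rewrite lerDl.
have [k rk] := ar (K := 1) g 0 isT li li.
have [s [_ [_ sg]]] := zero_reach rk.
have := grow s (1 * k)%N; rewrite sg /f map_mx0 mulmx0 mxE normr0 mul0r.
by rewrite real_leNgt ?ltr_pwDr ?real0 // realD // ?real1 // ger0_real.
Qed.

(* For a large common length L' there are loops of length N * L' whose P-heights
   are all the vectors with entries in {-1, 0, 1}. Concatenating them along the
   increments of floor (q * L' * v) realizes the rotation vector v. *)
Lemma all_reach_rot_interior N k (P : 'M[int]_(k, d)) i : (0 < N)%N -> live C i ->
  (forall x : V, P *m (A ^+ N *m x) = P *m x) -> (forall y : 'cV[int]_k, exists x, P *m x = y) ->
  zero_in_interior (rot_set (iter N sh) (fun s => P *m (iter N (tau A hh) (s, 0)).2)).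
Proof.
move=> N0 li PA Psurj.
pose vec (c : {ffun 'I_k -> 'I_3}) : 'cV[int]_k := \col_j ((c j : nat)%:Z - 1).
have [n0 n0P] : exists n0, forall c m, (n0 <= m)%N ->
    exists s : Sg, state_at s 0 = i /\ state_at s m = i /\ P *m disp m s = vec c.
  apply: fin_all_bound => [c m n mn mP p np|c]; first by apply: mP; apply: leq_trans np.
  have [x xE] := Psurj (vec c).
  have [n0 n0P] := all_reach_eventually ar 0 x li li.
  exists n0 => m /n0P/zero_reach[s [s0 [sm sx]]]; exists s; do !split=> //.
  by rewrite -xE -sx /hgt mulmx0 add0r.
pose L' := n0.+1; pose L := (N * L')%N.
have L0 : (0 < L)%N by rewrite muln_gt0 N0.
have /fin_all_exists[sc scP] c : exists s : Sg,
    state_at s 0 = i /\ state_at s L = i /\ P *m disp L s = vec c.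
  by apply: n0P; rewrite /L /L'; nia.
have L'R : Rlt 0 (INR L') by apply: lt_0_INR; lia.
(* This radius makes every |L' v_j| < 1, so the floors change by at most one per block. *)
exists (Rinv (INR L')); split; first exact: Rinv_0_lt_compat.
move=> v vP; pose u j := Rmult (INR L') (v j).
have u1 j : Rlt (Rabs (u j)) 1.
  rewrite /u Rabs_mult (Rabs_pos_eq (INR L')); last lra.
  by rewrite -(Rinv_r (INR L')); [apply: Rmult_lt_compat_l|lra].
pose F q j := floorR (Rmult (INR q) (u j)).
have /choice[c cP] q : exists c : {ffun 'I_k -> 'I_3}, forall j, F q.+1 j = F q j + vec c j 0.
  have /fin_all_exists[c cP] j : exists c : 'I_3, F q.+1 j = F q j + ((c : nat)%:Z - 1).
    have [c cE] := floorR_step (Rmult (INR q) (u j)) (u1 j); exists c; rewrite -cE /F S_INR.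
    by congr floorR; lra.
  by exists [ffun j => c j] => j; rewrite cP mxE ffunE.
have [||t tP] := @concat_blocks S C L i (fun q => sc (c (Z.to_nat q))) L0.
- by move=> q; case: (scP (c (Z.to_nat q))).
- by move=> q; case: (scP (c (Z.to_nat q))) => _ [].
have tE q r : (r <= L)%N -> state_at t (L * q + r) = state_at (sc (c q)) r.
  move=> rL; have := tP (Z.of_nat q) r rL; rewrite Nat2Z.id => <-.
  by rewrite /state_at; congr (sval t); lia.
have PAX q (x : V) : P *m (A ^+ (N * q) *m x) = P *m x.
  elim: q => [|q IHq]; first by rewrite muln0 mulmxX0.
  by rewrite mulnS mulmxXD PA.
have tF q j : (P *m disp (L * q) t) j 0 = F q j.
  elim: q => [|q IHq].
    by rewrite muln0 disp0 mulmx0 mxE /F Rmult_0_l floorR0.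
  rewrite mulnS addnC dispD mulmxDr addmx_entry {1}/L PAX IHq cP; congr (_ + _).
  have [_ [_ <-]] := scP (c q); congr ((_ *m _) _ _); apply: eq_disp => l lL.
  by rewrite state_iter_shift tE.
pose K := (\max_(c : {ffun 'I_k -> 'I_3}) \max_(r < L'.+1) \max_(j < k)
  absz ((P *m disp (N * r) (sc c)) j 0%R))%N.
have KP c' r j : (r <= L')%N -> (absz ((P *m disp (N * r) (sc c')) j 0%R) <= K)%N.
  move=> rL; apply: leq_trans (leq_bigmax c').
  apply: leq_trans (leq_bigmax (Ordinal (rL : (r < L'.+1)%N))).
  exact: (leq_bigmax (F := fun j : 'I_k => absz ((P *m disp (N * r) (sc c')) j 0%R)) j).
(* [K] accounts for the incomplete last block; the 2 covers the floor and the remainder r v_j, each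
   at most 1. *)
have main n j : Rle (Rabs (int2R ((P *m disp (N * n) t) j 0) - INR n * v j)) (INR K + 2).
  pose q := (n %/ L')%N; pose r := (n %% L')%N.
  have rL : (r < L')%N by rewrite ltn_pmod.
  have nE : n = (q * L' + r)%N by apply: divn_eq.
  have nE' : (N * n = L * q + N * r)%N by rewrite nE /L; lia.
  rewrite nE' dispD mulmxDr PAX addmx_entry int2RD tF.
  have -> : disp (N * r) (iter (L * q) sh t) = disp (N * r) (sc (c q)).
    apply: eq_disp => l lr; rewrite state_iter_shift tE //.
    by apply: leq_trans lr _; rewrite /L leq_mul2l ltnW ?orbT.
  have := int2R_abs (KP (c q) r j (ltnW rL)); move: (int2R _) => e eK.
  have [f1 f2] := floorRP (Rmult (INR q) (u j)); rewrite -/(F q j) in f1 f2.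
  have nR : INR n = Rplus (Rmult (INR q) (INR L')) (INR r).
    by rewrite nE plus_INR mult_INR.
  have rR : Rlt (INR r) (INR L') by apply: lt_INR; lia.
  have r0 := pos_INR r.
  have rv : Rle (Rabs (Rmult (INR r) (v j))) 1.
    rewrite Rabs_mult (Rabs_pos_eq _ r0).
    have := u1 j; rewrite /u Rabs_mult (Rabs_pos_eq (INR L')); last lra.
    have := Rabs_pos (v j); nra.
  have e1 : Rmult (INR n) (v j) = Rplus (Rmult (INR q) (u j)) (Rmult (INR r) (v j)).
    by rewrite nR /u; lra.
  rewrite e1; move: f1 f2 eK rv; split_Rabs; lra.
exists t => j eps eps0.
have [n1 n1P] := INR_archimed eps (INR K + 2) eps0.
exists n1.+1 => n nn; rewrite /Rdist.
have -> : \sum_(i0 < n) P *m (iter N (tau A hh) (iter i0 (iter N sh) t, 0)).2 = P *m disp (N * n) t.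
  exact: untwisted_sum.
have n0' : Rlt 0 (INR n) by apply: lt_0_INR; lia.
have nR : Rle (INR n1) (INR n) by apply: le_INR; lia.
have cancel a : Rmult (INR n) (Rdiv a (INR n)) = a.
  by rewrite /Rdiv -Rmult_assoc Rinv_r_simpl_m //; lra.
apply: (Rmult_lt_reg_l (INR n)) => //.
rewrite -{1}(Rabs_pos_eq (INR n)); last lra.
rewrite -Rabs_mult Rmult_minus_distr_l cancel.
have h : Rle (Rmult (INR n1) eps) (Rmult (INR n) eps) by apply: Rmult_le_compat_r; lra.
by apply: Rle_lt_trans (main n j) _; apply: Rlt_le_trans h.
Qed.

End Necessity.

(** * Assembly of the equivalences *)

Theorem mainTheorem3 (S : finType) (C : S -> S -> bool) (d : nat)
  (A : 'M[int]_d) (hh : S -> S -> 'cV[int]_d)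
  (hd : (0 < d)%N)
  (hdet : (\det A = 1 \/ \det A = -1)%R)
  (hne : inhabited (Sig C))
  (htr : top_transitive (@sig_open S C) (@sshift S C)) :
  (totally_transitive (@prod_open S C d) (@tau S C d A hh) <->
     (spec_radius_one A /\ @total_ftp S C d A hh /\
      exists N : nat, is_NA A N /\ @zero_in_int_rotF S C d A hh N)) /\
  (totally_transitive (@prod_open S C d) (@tau S C d A hh) <->
     (@total_ftp S C d A hh /\ periodic_dense (@prod_open S C d) (@tau S C d A hh))) /\
  (totally_transitive (@prod_open S C d) (@tau S C d A hh) <->
     top_mixing (@prod_open S C d) (@tau S C d A hh)).
Proof.
have Au : A \in unitmx.
  by rewrite unitmxE; case: hdet => ->.
case: hne => s; have li : live C (state_at s 0) by exists s.
case: d A hh hd hdet Au => // d' A hh _ _ Au {htr}.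
have mixing_a := @mixing_totally_transitive S C d'.+1 A hh.
(* Both (b) and (c) return to (a) through [all_reach] and mixing. *)
have reach_mixing (ar : all_reach C A hh) :=
  eventually_mixing Au (all_reach_eventually ar).
split; [split=> [tt|[_ [ft [N [[N0 [NA _]] rot]]]]]|split; split=> [tt|]].
- have ar := totally_transitive_reach Au tt.
  have A1 l : root (cpoly A) l -> (`|l| <= 1)%R by apply: (all_reach_spectrum ar li).
  split; first exact: spectral_radius_one.
  split; first exact: totally_transitive_ftp.
  have [N NP] := ex_NA A1 Au; exists N; split=> //; case: NP => N0 [NA _].
  have [k [P [k0 [Psurj Pker]]]] := fried_quotient (spec_one_det NA).
  exists k, P; do 3!split=> //.
  apply: (all_reach_rot_interior ar N0 li) => // x.
  (* [P] kills im(A^N - 1), which lies in its purification. *)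
  apply/eqP; rewrite -GRing.subr_eq0 -mulmxBr; apply/eqP/Pker => G _ _; apply.
  by exists x.
- apply: mixing_a; apply: reach_mixing; have [J nilJ] := spec_one_nilpotent NA.
  apply: (orb_all_reach Au N0 ft) => i k0 lvi k00.
  exact: (rot_transitive Au N0 lvi ft k00 nilJ rot).
- split; first exact: totally_transitive_ftp.
  exact/(all_reach_periodic Au)/totally_transitive_reach.
- move=> [ft pd]; apply: mixing_a; apply: reach_mixing.
  apply: (orb_all_reach Au (N := 1) isT ft) => i k0 lvi k00.
  have K0 : (0 < 1 * k0)%N by rewrite mul1n.
  apply: (symmetric_orb_transitive Au K0 lvi (@zero_subgroup d'.+1) _ ft).
    exact: zero_stable.
  exact: periodic_symmetric.
- exact/reach_mixing/totally_transitive_reach.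
- exact: mixing_a.
Qed.
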